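(* Let $p\ge 2$ and let $u$ be an ancient solution of the half-space problem $u_t-\Delta u=|\nabla u|^p$ in $Q:=\mathbb{R}^n_+\times(-\infty,0)$, $u=0$ on $\partial\mathbb{R}^n_+\times(-\infty,0)$. Then: (i) $u\ge0$ in $Q$. (ii) If $p>2$, then, with $\beta=1/(p-1)$ and a constant $C=C(n,p)>0$, $$u(x,t)\le C\big(x_n^{1-\beta}+x_n^{1+\beta}|t|^{-\beta}\big)\quad\text{and}\quad |\nabla u(x,t)|\le C\big(x_n^{-\beta}+x_n^{\beta}|t|^{-\beta}\big)\qquad\text{for all }(x,t)\in Q.$$
   Context: $\mathbb{R}^n_+:=\{x\in\mathbb{R}^n: x_n>0\}$. An ancient solution of the half-space problem is a function $u\in C^{2,1}(Q)\cap C(\overline Q)$ satisfying the PDE pointwise in $Q$ and $u=0$ pointwise on $\partial\mathbb{R}^n_+\times(-\infty,0)$. *)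

(* Defs.v *)
From HB Require Import structures.
From mathcomp Require Import all_boot all_order all_algebra.
From mathcomp Require Import all_classical all_reals all_analysis.
Set Implicit Arguments. Unset Strict Implicit. Unset Printing Implicit Defensive.
Import Order.TTheory GRing.Theory Num.Theory.
Import numFieldNormedType.Exports.
Local Open Scope classical_set_scope.
Local Open Scope ring_scope.

Section HalfSpace.
Variables (R : realType) (n : nat).

(* Spatial dimension is n.+1 (>= 1). Spatial points are row vectors
   x : 'rV[R]_n.+1, coordinates x 0 i, i : 'I_n.+1.
   A space-time function is u : 'rV[R]_n.+1 -> R -> R, u x t. *)

Definition xlast (x : 'rV[R]_n.+1) : R := x 0 ord_max.

Definition ebase (i : 'I_n.+1) : 'rV[R]_n.+1 := delta_mx 0 i.

Definition Qset : set ('rV[R]_n.+1 * R) := [set z | 0 < xlast z.1 /\ z.2 < 0].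
Definition Qclos : set ('rV[R]_n.+1 * R) := [set z | 0 <= xlast z.1 /\ z.2 <= 0].

Definition pdx (i : 'I_n.+1) (u : 'rV[R]_n.+1 -> R -> R) : 'rV[R]_n.+1 -> R -> R :=
  fun x t => 'D_(ebase i) (fun y => u y t) x.
Definition pdt (u : 'rV[R]_n.+1 -> R -> R) : 'rV[R]_n.+1 -> R -> R :=
  fun x t => 'D_1 (u x) t.

Definition gradnorm (u : 'rV[R]_n.+1 -> R -> R) (x : 'rV[R]_n.+1) (t : R) : R :=
  Num.sqrt (\sum_(i < n.+1) (pdx i u x t) ^+ 2).
Definition lap (u : 'rV[R]_n.+1 -> R -> R) (x : 'rV[R]_n.+1) (t : R) : R :=
  \sum_(i < n.+1) pdx i (pdx i u) x t.

Definition unc (u : 'rV[R]_n.+1 -> R -> R) : 'rV[R]_n.+1 * R -> R :=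
  fun z => u z.1 z.2.

Definition C21_Q (u : 'rV[R]_n.+1 -> R -> R) : Prop :=
  forall z, Qset z ->
    [/\ (forall i : 'I_n.+1, derivable (fun y => u y z.2) z.1 (ebase i)),
        (forall i j : 'I_n.+1, derivable (fun y => pdx j u y z.2) z.1 (ebase i)) &
        derivable (u z.1) z.2 1] /\
    [/\ {for z, continuous (unc u)},
        (forall i : 'I_n.+1, {for z, continuous (unc (pdx i u))}),
        (forall i j : 'I_n.+1, {for z, continuous (unc (pdx i (pdx j u)))}) &
        {for z, continuous (unc (pdt u))}].

Definition ancient_solution (p : R) (u : 'rV[R]_n.+1 -> R -> R) : Prop :=
  [/\ C21_Q u,
      {within Qclos, continuous (unc u)},
      (forall x t, 0 < xlast x -> t < 0 ->
         pdt u x t - lap u x t = (gradnorm u x t) `^ p) &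
      (forall x t, xlast x = 0 -> t < 0 -> u x t = 0)].

End HalfSpace.

(* Main.v *)
Require Import Defs.
From HB Require Import structures.
From mathcomp Require Import all_boot all_order all_algebra.
From mathcomp Require Import all_classical all_reals all_analysis.
From mathcomp Require Import ring lra.
Import Order.TTheory GRing.Theory Num.Theory.
Import numFieldNormedType.Exports.
Local Open Scope classical_set_scope.
Local Open Scope ring_scope.
Set Implicit Arguments. Unset Strict Implicit. Unset Printing Implicit Defensive.

(** No regularity beyond C^{2,1} is needed: every step compares [u], at an
    extremum over a compact set, with an explicit function, so only the first
    and second derivative tests along coordinate lines are used.

    (i) With the centre at depth [s^2] below the boundary, the radial function
    [A ln (1 - (r - s^4)/s^3 - (t0 - t)/s^3)] of the squared distance [r] is a
    strict subsolution, nonpositive in the half-space and singular where the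
    logarithm vanishes. It stays below [u], and its value at a given point
    tends to 0 as [s] tends to infinity.

    (ii) Upper bound: in a ball of radius 1 inside the half-space consider
    [M - spike - cap], where the spike concentrates at the centre at the initial
    time and the cap has infinite slope on the sphere. Since [p > 2] gradients
    add superadditively and this is a strict subsolution; the infinite slope
    excludes minima of the difference on the sphere, so [u] at the centre is
    bounded by [u] at a later time on the sphere, hence, the sphere tending to
    the boundary where [u = 0], by a constant. Scaling gives the general case.

    Gradient bound: where [0 <= u <= N], the function [l = ln (2N - u)] solves
    [l_t - lap l = |grad l|^2 - (2N - u)^(p-1) |grad l|^p]. Doubling variables,
    a positive maximum of [l(y,t) - l(x,t) - L w(x,t) (|x - y| + ep)], with [w]
    infinite on the parabolic boundary, is impossible: the factor
    [(2N - u)^(p-1)] differs at [x] and [y] by at least a multiple of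
    [L w (|x - y| + ep)], which beats all localisation errors because these are
    also proportional to [|x - y| + ep]. This is Bernstein's argument without
    differentiating the equation. *)

(** * Derivative tests along coordinate lines *)

Lemma is_derive_eps (R : realType) (f : R -> R) (x c e : R) :
  is_derive x 1 f c -> 0 < e ->
  exists2 d, 0 < d & forall h, `|h| < d -> `|f (x + h) - f x - c * h| <= e * `|h|.
Proof.
move=> [df Df] e0.
have : (fun h => h^-1 *: (f (h *: 1 + x) - f x)) @ 0^' --> c by rewrite -Df; apply: df.
move=> /cvgrPdist_le /(_ e e0); rewrite near_withinE.
move=> /nbhs_ballP [d /= d0 H]; exists d => // h hd.
have [->|h0] := eqVneq h 0; first by rewrite addr0 subrr mulr0 subr0 normr0 mulr0.
have := H h; rewrite /ball/= sub0r normrN => /(_ hd h0).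
rewrite -(ler_pM2r (_ : 0 < `|h|)) ?normr_gt0// -normrM => H'; apply: le_trans H'.
by rewrite !/GRing.scale/= mulr1 (addrC h) mulrBl mulrAC mulVf// mul1r distrC.
Qed.

Lemma deriv_left_min (R : realType) (f : R -> R) (x c d : R) :
  is_derive x 1 f c -> 0 < d -> (forall s : R, x - d < s < x -> f x <= f s) -> c <= 0.
Proof.
move=> fc d0 H; rewrite leNgt; apply/negP => c0.
have c1 : 0 < c / 2 by lra.
have [d' d'0 Hd] := is_derive_eps fc c1.
pose h := Num.min (d / 2) (d' / 2).
have h0 : 0 < h by rewrite lt_min !divr_gt0.
have hd : h < d by rewrite gt_min; apply/orP; left; lra.
have hd' : h < d' by rewrite gt_min; apply/orP; right; lra.
have := Hd (- h); rewrite normrN gtr0_norm// => /(_ hd').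
rewrite ler_norml => /andP[_].
have /H : x - d < x - h < x by apply/andP; split; lra.
nra.
Qed.

Lemma deriv_right_min (R : realType) (f : R -> R) (x c d : R) :
  is_derive x 1 f c -> 0 < d -> (forall s : R, x < s < x + d -> f x <= f s) -> 0 <= c.
Proof.
move=> fc d0 H; rewrite leNgt; apply/negP => c0.
have c1 : 0 < - c / 2 by lra.
have [d' d'0 Hd] := is_derive_eps fc c1.
pose h := Num.min (d / 2) (d' / 2).
have h0 : 0 < h by rewrite lt_min !divr_gt0.
have hd : h < d by rewrite gt_min; apply/orP; left; lra.
have hd' : h < d' by rewrite gt_min; apply/orP; right; lra.
have := Hd h; rewrite gtr0_norm// => /(_ hd').
rewrite ler_norml => /andP[_].
have /H : x < x + h < x + d by apply/andP; split; lra.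
nra.
Qed.

Lemma deriv_min (R : realType) (f : R -> R) (c d : R) :
  is_derive (0 : R) 1 f c -> 0 < d -> (forall s : R, `|s| < d -> f 0 <= f s) -> c = 0.
Proof.
move=> fc d0 H; apply/eqP; rewrite eq_le; apply/andP; split.
  apply: (@deriv_left_min R f 0 c d) => // s /andP[s1 s2].
  by apply: H; rewrite ltr_norml; apply/andP; split; lra.
apply: (@deriv_right_min R f 0 c d) => // s /andP[s1 s2].
by apply: H; rewrite ltr_norml; apply/andP; split; lra.
Qed.

(** The first derivative test gives [g 0 = 0]. If [c < 0], then [g] is negative just to the right of
    0, and the mean value theorem makes [f] drop below [f 0]. *)
Lemma deriv2_min (R : realType) (f g : R -> R) (c d : R) : 0 < d ->
  (forall s : R, `|s| < d -> is_derive s 1 f (g s)) -> is_derive (0 : R) 1 g c ->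
  (forall s : R, `|s| < d -> f 0 <= f s) -> 0 <= c.
Proof.
move=> d0 fg gc H; rewrite leNgt; apply/negP => c0.
have g0 : g 0 = 0.
  by apply: (@deriv_min R f _ d) => //; apply: fg; rewrite normr0.
have c1 : 0 < - c / 2 by lra.
have [d' d'0 Hd] := is_derive_eps gc c1.
pose h := Num.min (d / 2) (d' / 2).
have h0 : 0 < h by rewrite lt_min !divr_gt0.
have hd : h < d by rewrite gt_min; apply/orP; left; lra.
have hd' : h < d' by rewrite gt_min; apply/orP; right; lra.
have [||s] := @MVT R f g 0 h h0.
- move=> s; rewrite in_itv/= => /andP[s1 s2]; apply: fg.
  by rewrite ltr_norml; apply/andP; split; lra.
- apply: derivable_within_continuous => s; rewrite in_itv/= => /andP[s1 s2].
  apply: (@ex_derive _ _ _ _ _ _ (g s)); apply: fg.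
  by rewrite ltr_norml; apply/andP; split; lra.
rewrite in_itv/= => /andP[s1 s2].
have := H h; rewrite gtr0_norm// => /(_ hd) fh.
have := Hd s; rewrite gtr0_norm// add0r g0 subr0 => /(_ (lt_trans s2 hd')).
rewrite ler_norml => /andP[_ h3] h4.
have : g s < 0 by nra.
nra.
Qed.

Section Lines.
Variables (R : realType) (n : nat).
Implicit Types (f : 'rV[R]_n.+1 -> R) (x : 'rV[R]_n.+1) (i : 'I_n.+1).

Lemma is_derive_line f x i s : derivable f (x + s *: ebase R i) (ebase R i) ->
  is_derive s 1 (fun r => f (x + r *: ebase R i)) ('D_(ebase R i) f (x + s *: ebase R i)).
Proof.
move=> df; set e := ebase R i in df *.
have E : (fun h : R => h^-1 *: (f (x + (h *: 1 + s) *: e) - f (x + s *: e))) =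
   (fun h : R => h^-1 *: (f (h *: e + (x + s *: e)) - f (x + s *: e))).
  apply/funext => h; congr (_ *: (f _ - _)).
  by rewrite /(h *: 1)/= mulr1 scalerDl addrCA.
split; first by rewrite /derivable/= E.
by rewrite /derive/= E.
Qed.

(** The squared Euclidean norm; [|x|] on row vectors is the maximum norm. *)
Definition sqn x := \sum_(i < n.+1) (x 0 i) ^+ 2.

Lemma sqn_ge0 x : 0 <= sqn x.
Proof. by apply: sumr_ge0 => i _; exact: sqr_ge0. Qed.

Lemma sqn_line x i s : sqn (x + s *: ebase R i) = sqn x + 2 * s * x 0 i + s ^+ 2.
Proof.
rewrite /sqn (bigD1 i)//= [in RHS](bigD1 i)//= !mxE !eqxx/=.
under eq_bigr => j ji do rewrite !mxE eqxx (negbTE ji)/= mulr0 addr0.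
rewrite mulr1; ring.
Qed.

Lemma coord_sqn x i : (x 0 i) ^+ 2 <= sqn x.
Proof.
by rewrite /sqn (bigD1 i)//= lerDl; apply: sumr_ge0 => j _; exact: sqr_ge0.
Qed.

Lemma sqnB x y : sqn (x - y) = sqn (y - x).
Proof. by apply: eq_bigr => i _; rewrite !mxE; ring. Qed.

Lemma sqn0 : sqn 0 = 0.
Proof. by rewrite /sqn big1// => i _; rewrite mxE expr0n. Qed.

Lemma sqn_eq0 x : (sqn x == 0) = (x == 0).
Proof.
apply/eqP/eqP => [x0|->]; last exact: sqn0.
apply/rowP => i; rewrite mxE; apply/eqP; rewrite -sqrf_eq0 eq_le sqr_ge0 andbT.
by rewrite -x0 coord_sqn.
Qed.

End Lines.

(** * Differentiation rules for real functions *)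

Section Rules.
Variable R : realType.
Implicit Types (f g : R -> R) (x a b c : R).

Lemma is_derive_continuous f x a : is_derive x 1 f a -> {for x, continuous f}.
Proof. by move=> [fx _]; apply: differentiable_continuous; apply/derivable1_diffP. Qed.

Lemma is_derive_const x c : is_derive x 1 (fun=> c) 0.
Proof. exact: is_derive_cst. Qed.

Lemma is_derive_ident x : is_derive x 1 (fun y : R => y) 1.
Proof. exact: is_derive_id. Qed.

Lemma is_derive_add f g x a b : is_derive x 1 f a -> is_derive x 1 g b ->
  is_derive x 1 (fun y => f y + g y) (a + b).
Proof. by move=> fa gb; exact: (is_deriveD fa gb). Qed.

Lemma is_derive_opp f x a : is_derive x 1 f a -> is_derive x 1 (fun y => - f y) (- a).
Proof. by move=> fa; exact: (is_deriveN fa). Qed.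

Lemma is_derive_mul f g x a b : is_derive x 1 f a -> is_derive x 1 g b ->
  is_derive x 1 (fun y => f y * g y) (f x * b + g x * a).
Proof. by move=> fa gb; exact: (is_deriveM fa gb). Qed.

Lemma is_derive_sqr f x a : is_derive x 1 f a -> is_derive x 1 (fun y => f y ^+ 2) (2 * f x * a).
Proof.
move=> fa; have H := is_derive_mul fa fa.
by apply: (is_derive_eq H); ring.
Qed.

Lemma is_derive_chain f g x a b : is_derive (g x) 1 f a -> is_derive x 1 g b ->
  is_derive x 1 (fun y => f (g y)) (a * b).
Proof. by move=> fa gb; exact: (is_derive1_comp fa gb). Qed.

Lemma is_derive_recip f x a : f x != 0 -> is_derive x 1 f a ->
  is_derive x 1 (fun y => (f y)^-1) (- a / f x ^+ 2).
Proof.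
move=> f0 fa; apply: (is_derive_eq (is_deriveV f0 fa)).
by rewrite /GRing.scale/= mulNr mulNr mulrC.
Qed.

Lemma is_derive_ln f x a : 0 < f x -> is_derive x 1 f a -> is_derive x 1 (fun y => ln (f y)) (a / f x).
Proof.
by move=> f0 fa; apply: (is_derive_eq (is_derive_chain (is_derive1_ln f0) fa)); rewrite mulrC.
Qed.

Lemma is_derive_powR f x a c : 0 < f x -> is_derive x 1 f a ->
  is_derive x 1 (fun y => f y `^ c) (c * f x `^ (c - 1) * a).
Proof. by move=> f0 fa; exact: (@is_derive_chain (fun y => y `^ c) _ _ _ _ (is_derive1_powR c f0) fa). Qed.

End Rules.

(** Differentiates by structure with the value left open. What remains are the side conditions not
    found in the context and, last, the equality of the computed value with the claimed one. *)
Ltac derive_rules := notypeclasses refine (is_derive_eq _ _); [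
  repeat first [ eassumption | notypeclasses refine (is_derive_const _ _)
   | notypeclasses refine (is_derive_ident _) | notypeclasses refine (is_derive_add _ _)
   | notypeclasses refine (is_derive_opp _) | notypeclasses refine (is_derive_sqr _)
   | notypeclasses refine (is_derive_mul _ _) | notypeclasses refine (is_derive_recip _ _)
   | notypeclasses refine (is_derive_ln _ _) | notypeclasses refine (is_derive_powR _ _ _) ] | cbv beta ].

(** * Test functions touching a solution from below *)

Section Touching.
Variables (R : realType) (n : nat).
Implicit Types (u : 'rV[R]_n.+1 -> R -> R) (x c : 'rV[R]_n.+1) (i : 'I_n.+1) (p t s : R).

Lemma xlast_line x i s : `|s| < xlast x -> 0 < xlast (x + s *: ebase R i).
Proof.
rewrite /xlast !mxE eqxx/= ltr_norml => /andP[s1 s2].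
by case: (_ == _); rewrite ?mulr1 ?mulr0; lra.
Qed.

Lemma C21_line u x i t s : C21_Q u -> t < 0 -> `|s| < xlast x ->
  is_derive s 1 (fun r => u (x + r *: ebase R i) t) (pdx i u (x + s *: ebase R i) t).
Proof.
move=> uC t0 sx; apply: (@is_derive_line R n (u^~ t)).
have [|[+ _ _] _] := uC (x + s *: ebase R i, t); first by split => //=; exact: xlast_line.
exact.
Qed.

Lemma C21_line2 u x i t : C21_Q u -> t < 0 -> 0 < xlast x ->
  is_derive (0 : R) 1 (fun r => pdx i u (x + r *: ebase R i) t) (pdx i (pdx i u) x t).
Proof.
move=> uC t0 x0.
have -> : pdx i (pdx i u) x t = 'D_(ebase R i) ((pdx i u)^~ t) (x + 0 *: ebase R i).
  by rewrite scale0r addr0.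
apply: is_derive_line; rewrite scale0r addr0.
by have [|[_ + _] _] := uC (x, t).
Qed.

Lemma C21_time u x t : C21_Q u -> t < 0 -> 0 < xlast x -> is_derive t 1 (u x) (pdt u x t).
Proof.
by move=> uC t0 x0; have [|[_ _ H] _] := uC (x, t); [|exact: derivableP].
Qed.

(** At such a minimum [u] has the gradient of the test function, at least its second derivatives and
    at most its time derivative, so the equation for [u] becomes an inequality for the test
    function. Only its restrictions [V i] and [W] to lines through the point are prescribed. Only
    earlier times are compared, which admits minima at a final time. *)
Lemma touching p u x t d (V G : 'I_n.+1 -> R -> R) (V2 : 'I_n.+1 -> R) (W : R -> R) Vt :
  ancient_solution p u -> 0 < xlast x -> t < 0 -> 0 < d ->
  (forall i s, `|s| < d -> is_derive s 1 (V i) (G i s)) ->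
  (forall i, is_derive (0 : R) 1 (G i) (V2 i)) -> is_derive t 1 W Vt ->
  (forall i s, `|s| < d -> u x t - V i 0 <= u (x + s *: ebase R i) t - V i s) ->
  (forall s, t - d < s < t -> u x t - W t <= u x s - W s) ->
  Num.sqrt (\sum_i (G i 0) ^+ 2) `^ p <= Vt - \sum_i V2 i.
Proof.
move=> [uC _ ueq _] x0 t0 d0 VG GV2 Wt minx mint.
pose e := Num.min d (xlast x).
have e0 : 0 < e by rewrite lt_min d0.
have ed (r : R) : r < e -> r < d by rewrite lt_min => /andP[].
have ex (r : R) : r < e -> r < xlast x by rewrite lt_min => /andP[].
have H1 i s : `|s| < e ->
    is_derive s 1 (fun r => u (x + r *: ebase R i) t - V i r)
      (pdx i u (x + s *: ebase R i) t - G i s).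
  by move=> se; exact: (is_derive_add (C21_line i uC t0 (ex _ se)) (is_derive_opp (VG i s (ed _ se)))).
have H2 i : is_derive (0 : R) 1 (fun s => pdx i u (x + s *: ebase R i) t - G i s)
     (pdx i (pdx i u) x t - V2 i).
  exact: (is_derive_add (C21_line2 i uC t0 x0) (is_derive_opp (GV2 i))).
have H3 i s : `|s| < e -> u (x + 0 *: ebase R i) t - V i 0 <= u (x + s *: ebase R i) t - V i s.
  by move=> se; rewrite scale0r addr0; apply: minx; exact: ed.
have E1 i : pdx i u x t = G i 0.
  have := @deriv_min R _ _ e (H1 i 0 _) e0 (H3 i).
  by rewrite normr0 scale0r addr0 => /(_ e0)/eqP; rewrite subr_eq0 => /eqP.
have E2 i : V2 i <= pdx i (pdx i u) x t.
  by rewrite -subr_ge0; apply: (deriv2_min e0 (H1 i) (H2 i) (H3 i)).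
have E3 : pdt u x t <= Vt.
  rewrite -subr_le0; apply: (@deriv_left_min R (fun s => u x s - W s) t _ d) => //.
  exact: (is_derive_add (C21_time uC t0 x0) (is_derive_opp Wt)).
have <- : gradnorm u x t = Num.sqrt (\sum_i (G i 0) ^+ 2).
  by rewrite /gradnorm; congr Num.sqrt; apply: eq_bigr => i _; rewrite E1.
rewrite -ueq//; apply: lerB => //; apply: ler_sum => i _; exact: E2.
Qed.

Lemma radial_line (F : R -> R) (F1 : R -> R) (F2 d : R) x c i : 0 < d ->
  (forall r : R, `|r - sqn (x - c)| < d -> is_derive r 1 F (F1 r)) ->
  is_derive (sqn (x - c)) 1 F1 F2 ->
  let V s := F (sqn (x + s *: ebase R i - c)) in
  let G s := F1 (sqn (x + s *: ebase R i - c)) * (2 * (x - c) 0 i + 2 * s) in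
  (exists2 e, 0 < e & forall s, `|s| < e -> is_derive s 1 V (G s)) /\
  is_derive (0 : R) 1 G (2 * F1 (sqn (x - c)) + 4 * (x - c) 0 i ^+ 2 * F2).
Proof.
move=> d0 FF FF2 V G; set y := x - c in FF FF2 *.
have E s : x + s *: ebase R i - c = y + s *: ebase R i by rewrite addrAC.
have D s : is_derive s 1 (fun r => sqn (x + r *: ebase R i - c)) (2 * y 0 i + 2 * s).
  rewrite (_ : (fun r => _) = (fun r => sqn y + 2 * r * y 0 i + r ^+ 2)); last first.
    by apply/funext => r; rewrite E sqn_line.
  by derive_rules; ring.
split.
  (* For [|s| < 1] the squared distance moves by at most [k |s|]. *)
  pose k := 2 * `|y 0 i| + 1.
  have k0 : 0 < k by rewrite /k; have := normr_ge0 (y 0 i); lra.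
  exists (Num.min 1 (d / k)); first by rewrite lt_min ltr01 divr_gt0.
  move=> s; rewrite lt_min => /andP[s1]; rewrite ltr_pdivlMr// => sk.
  apply: (is_derive_chain _ (D s)); apply: FF; rewrite E sqn_line.
  rewrite (_ : _ - _ = 2 * s * y 0 i + s ^+ 2); last by ring.
  apply: le_lt_trans sk; apply: le_trans (ler_normD _ _) _.
  rewrite normrX !normrM /k; have := normr_ge0 s; have := normr_ge0 (y 0 i).
  by rewrite gtr0_norm//; nra.
have D0 : is_derive (0 : R) 1 (fun s => 2 * y 0 i + 2 * s) 2 by derive_rules; ring.
have D1 : is_derive (sqn (x + 0 *: ebase R i - c)) 1 F1 F2 by rewrite scale0r addr0.
apply: (is_derive_eq (is_derive_mul (is_derive_chain D1 (D 0)) D0)).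
by rewrite E scale0r addr0 /=; ring.
Qed.

(** A function [F] of [r = |x - c|^2] has a gradient of length [2 sqrt r |F1|] and Laplacian
    [2 n.+1 F1 + 4 r F2]; these are the sums over [i] in [touching]. *)
Lemma radial_touching p u x c t d (F : R -> R -> R) (F1 : R -> R) (F2 Ft : R) :
  ancient_solution p u -> 0 < xlast x -> t < 0 -> 0 < d ->
  (forall r : R, `|r - sqn (x - c)| < d -> is_derive r 1 (F^~ t) (F1 r)) ->
  is_derive (sqn (x - c)) 1 F1 F2 -> is_derive t 1 (F (sqn (x - c))) Ft ->
  (forall i s, `|s| < d -> u x t - F (sqn (x - c)) t <=
     u (x + s *: ebase R i) t - F (sqn (x + s *: ebase R i - c)) t) ->
  (forall s, t - d < s < t -> u x t - F (sqn (x - c)) t <= u x s - F (sqn (x - c)) s) ->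
  (2 * Num.sqrt (sqn (x - c)) * `|F1 (sqn (x - c))|) `^ p <=
  Ft - (2 * n.+1%:R * F1 (sqn (x - c)) + 4 * sqn (x - c) * F2).
Proof.
move=> us x0 t0 d0 FF FF2 Fft minx mint; set y := x - c in FF FF2 Fft minx mint *.
pose V i s := F (sqn (x + s *: ebase R i - c)) t.
pose G i s := F1 (sqn (x + s *: ebase R i - c)) * (2 * (x - c) 0 i + 2 * s).
have RL i := radial_line i d0 FF FF2.
have [e e0 He] : exists2 e, 0 < e & forall i s, `|s| < e -> is_derive s 1 (V i) (G i s).
  have /choice[e He] : forall i, exists e, 0 < e /\ forall s, `|s| < e -> is_derive s 1 (V i) (G i s).
    by move=> i; have [[e e0 He] _] := RL i; exists e.
  exists (\big[Num.min/1]_i e i); first by apply: lt_bigmin => // i _; case: (He i).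
  move=> i s si; apply: (He i).2; apply: lt_le_trans si _; exact: bigmin_le_cond.
pose m := Num.min e d.
have m0 : 0 < m by rewrite lt_min e0.
have H := @touching p u x t m V G (fun i => 2 * F1 (sqn y) + 4 * y 0 i ^+ 2 * F2) (F (sqn y)) Ft us x0 t0 m0.
have -> : 2 * Num.sqrt (sqn y) * `|F1 (sqn y)| = Num.sqrt (\sum_i G i 0 ^+ 2).
  rewrite /G (eq_bigr (fun i => (2 * F1 (sqn y)) ^+ 2 * y 0 i ^+ 2)); last first.
    by move=> i _; rewrite scale0r addr0 /y; ring.
  rewrite -mulr_sumr sqrtrM ?sqr_ge0// sqrtr_sqr normrM ger0_norm//.
  by rewrite -/(sqn y); ring.
have -> : 2 * n.+1%:R * F1 (sqn y) + 4 * sqn y * F2 = \sum_i (2 * F1 (sqn y) + 4 * y 0 i ^+ 2 * F2).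
  rewrite big_split/= sumr_const card_ord -mulr_natr; congr (_ + _); first by ring.
  by rewrite /sqn mulr_sumr mulr_suml; apply: eq_bigr => i _; ring.
apply: H => //.
- by move=> i s; rewrite lt_min => /andP[+ _]; exact: He.
- by move=> i; exact: (RL i).2.
- move=> i s; rewrite lt_min => /andP[_ sd]; rewrite /V scale0r addr0; exact: minx.
- move=> s /andP[s1 s2]; apply: mint; rewrite s2 andbT.
  by apply: le_lt_trans s1; rewrite lerB// ge_min lexx orbT.
Qed.

End Touching.

(** * Comparison with radial functions *)

Section Topology.
Variables (R : realType) (n : nat).
Notation point := ('rV[R]_n.+1 * R)%type.

Lemma sqn_continuous : continuous (@sqn R n).
Proof.
apply: (@continuous_big _ _ _ _ xpredT add_continuous) => i _ x.
by have H := @coord_continuous R 1 n.+1 0 i x; exact: (cvgM H H).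
Qed.

Lemma cvg_sqn T (F : set_system T) {FF : Filter F} (f : T -> 'rV[R]_n.+1) x :
  f @ F --> x -> (fun z => sqn (f z)) @ F --> sqn x.
Proof. by move=> fx; apply: continuous_cvg fx; exact: sqn_continuous. Qed.

Lemma cvg_xlast T (F : set_system T) {FF : Filter F} (f : T -> 'rV[R]_n.+1) x :
  f @ F --> x -> (fun z => xlast (f z)) @ F --> xlast x.
Proof. by move=> fx; apply: continuous_cvg fx; exact: coord_continuous. Qed.

Lemma sqn1_continuous (c : 'rV[R]_n.+1) : continuous (fun z : point => sqn (z.1 - c)).
Proof. by move=> z; apply: cvg_sqn; apply: cvgB; [exact: cvg_fst | exact: cvg_cst]. Qed.

Lemma xlast1_continuous : continuous (fun z : point => xlast z.1).
Proof. by move=> z; apply: cvg_xlast; exact: cvg_fst. Qed.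

Lemma closed_le_fun (T : topologicalType) (f g : T -> R) :
  continuous f -> continuous g -> closed [set z | f z <= g z].
Proof.
move=> cf cg.
have -> : [set z | f z <= g z] = (fun z => g z - f z) @^-1` [set y | 0 <= y].
  by apply/seteqP; split => z /=; rewrite subr_ge0.
apply: closed_comp; last exact: closed_ge.
by move=> z _; apply: cvgB; [exact: cg | exact: cf].
Qed.

Lemma compact_ball_sqn (c : 'rV[R]_n.+1) (r : R) : compact [set x | sqn (x - c) <= r].
Proof.
apply: bounded_closed_compact; last first.
  have cf : continuous (fun x : 'rV[R]_n.+1 => sqn (x - c)).
    move=> x; have H : (fun y : 'rV[R]_n.+1 => y - c) @ x --> x - c.
      by apply: (@cvgB R 'rV[R]_n.+1 _ (nbhs x) (nbhs_filter x) id (fun=> c) x c);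
        [exact: cvg_id | exact: cvg_cst].
    exact: (continuous_cvg (nbhs_filter x) (@sqn_continuous (x - c)) H).
  exact: (closed_le_fun cf (@cst_continuous _ _ r)).
have [r0|r0] := leP 0 r; last first.
  exists 0; split => // M _ x /= xr; exfalso.
  by have := le_lt_trans (le_trans (sqn_ge0 _) xr) r0; rewrite ltxx.
exists (Num.sqrt r + `|c|); split; first by rewrite num_real.
move=> M rM x /= xr; apply: le_trans (ltW rM).
rewrite -{1}(subrK c x); apply: le_trans (ler_normD _ _) _; rewrite lerD2r.
rewrite [leLHS]/Num.norm/= mx_normrE; apply: bigmax_le; first exact: sqrtr_ge0.
move=> [i j] _ /=; rewrite (ord1 i) -sqrtr_sqr ler_sqrt//.
exact: le_trans (coord_sqn _ _) xr.
Qed.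

Lemma compact_cylinder (c : 'rV[R]_n.+1) (r a b : R) :
  compact [set z : point | sqn (z.1 - c) <= r /\ a <= z.2 <= b].
Proof.
rewrite (_ : [set z | _] = [set x | sqn (x - c) <= r] `*` `[a, b]).
  by apply: compact_setX; [exact: compact_ball_sqn | exact: segment_compact].
by apply/seteqP; split => z /=; rewrite in_itv.
Qed.

Lemma near_lines (x : 'rV[R]_n.+1) (t : R) (P : point -> Prop) : (\forall z \near (x, t), P z) ->
  exists2 d, 0 < d & (forall i s, `|s| < d -> P (x + s *: ebase R i, t)) /\
     (forall s, t - d < s < t -> P (x, s)).
Proof.
move=> /nbhs_ballP [d /= d0 H]; exists d => //; split => [i s sd|s /andP[s1 s2]]; apply: H.
  split => /=; last exact: ballxx.
  split=> // j k; rewrite /ball/= !mxE opprD addrA subrr sub0r normrN normrM.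
  by case: (_ && _); rewrite ?normr1 ?normr0 ?mulr1 ?mulr0.
by split => /=; [exact: ballxx | rewrite /ball/= gtr0_norm; lra].
Qed.

End Topology.

Section Comparison.
Variables (R : realType) (n : nat).
Notation point := ('rV[R]_n.+1 * R)%type.
Implicit Types (u : 'rV[R]_n.+1 -> R -> R) (x c : 'rV[R]_n.+1) (p t : R).

(** The form in which barriers are used: each of them satisfies the reverse strict inequality, so
    [u - F] can have no such local minimum. *)
Lemma radial_comparison p u x c t (F : R -> R -> R) (F1 : R -> R) (F2 Ft : R) :
  ancient_solution p u -> 0 < xlast x -> t < 0 ->
  (\forall r \near (sqn (x - c) : R), is_derive (r : R) 1 (F^~ t) (F1 r)) ->
  is_derive (sqn (x - c)) 1 F1 F2 -> is_derive t 1 (F (sqn (x - c))) Ft ->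
  (\forall z \near (x, t), z.2 <= t ->
     u x t - F (sqn (x - c)) t <= u z.1 z.2 - F (sqn (z.1 - c)) z.2) ->
  (2 * Num.sqrt (sqn (x - c)) * `|F1 (sqn (x - c))|) `^ p <=
  Ft - (2 * n.+1%:R * F1 (sqn (x - c)) + 4 * sqn (x - c) * F2).
Proof.
move=> us x0 t0 /nbhs_ballP[d1 /= d10 FF] FF2 Fft /near_lines[d2 d20 [H1 H2]].
pose d := Num.min d1 d2.
have d0 : 0 < d by rewrite lt_min d10.
apply: (@radial_touching R n p u x c t d F F1 F2 Ft) => //.
- by move=> r; rewrite lt_min => /andP[rd _]; apply: FF; rewrite /ball/= distrC.
- by move=> i s; rewrite lt_min => /andP[_ sd]; exact: (H1 i s sd).
- move=> s /andP[s1 s2]; apply: (H2 s); last exact: ltW.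
  by rewrite s2 andbT; apply: le_lt_trans s1; rewrite lerB// ge_min lexx orbT.
Qed.

Lemma ancient_continuous p u (K : set point) : ancient_solution p u -> K `<=` @Qclos R n ->
  {within K, continuous (unc u)}.
Proof. by move=> [_ uc _ _] KQ; exact: continuous_subspaceW KQ uc. Qed.

Lemma comparison_min p u (K : set point) (w : point -> R) : ancient_solution p u ->
  compact K -> K !=set0 -> K `<=` @Qclos R n -> {within K, continuous w} ->
  exists2 z, K z & forall z', K z' -> unc u z - w z <= unc u z' - w z'.
Proof.
move=> us cK K0 KQ cw.
have cuw : {within K, continuous (fun z => unc u z - w z)}.
  by move=> z; apply: cvgB; [exact: (ancient_continuous us KQ) | exact: cw].
have [z zK H] := compact_EVT_min K0 cK cuw.
by exists z; [rewrite inE in zK | move=> z' z'K; apply: H; rewrite inE].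
Qed.

End Comparison.

(** * Nonnegativity *)

Section Nonneg.
Variables (R : realType) (n : nat) (p : R).
Notation point := ('rV[R]_n.+1 * R)%type.
Notation d := (n.+1%:R : R).
Notation be := ((p - 1)^-1).

Lemma powR_le (a b r : R) : 0 <= r -> 0 <= a -> a <= b -> a `^ r <= b `^ r.
Proof.
by move=> r0 a0 ab; apply: ge0_ler_powR => //; rewrite nnegrE// (le_trans a0).
Qed.

Lemma powR_ge1 (a r : R) : 0 <= r -> 1 <= a -> 1 <= a `^ r.
Proof. by move=> r0 a1; have := powR_le r0 ler01 a1; rewrite powR1. Qed.

(* [G] stands for [|grad w| / A]: the logarithmic barrier [w] is a strict subsolution for this value of [A]. *)
Lemma log_barrier_num (s G X A : R) : 1 <= s -> 2 / s <= G -> X < G ^+ 2 -> 2 <= p ->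
  A = 2 * s `^ (1 - be) -> A * (X + G ^+ 2) < (A * G) `^ p.
Proof.
move=> s1 Gs XG hp AE.
have s0 : 0 < s by lra.
have G0 : 0 < G by apply: lt_le_trans Gs; rewrite divr_gt0.
have A0 : 0 < A by rewrite AE mulr_gt0// powR_gt0.
have q1 : 1 <= p - 1 by lra.
(* The exponent [1 - be] puts [s ^ (p - 2)] into [A ^ (p - 1)]. It combines with [G ^ (p - 2)] into
   a power of [s G >= 2], and the factor 2 that is left absorbs [X < G ^ 2]. *)
have EA : A `^ (p - 1) = 2 `^ (p - 1) * s `^ (p - 2).
  rewrite AE powRM ?powR_ge0// -powRrM; congr (_ * _ `^ _).
  by rewrite mulrBl mul1r mulVf ?gt_eqF//; lra.
have EG : (A * G) `^ p = A * G ^+ 2 * (A `^ (p - 1) * G `^ (p - 2)).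
  have -> : (A * G) `^ p = A * A `^ (p - 1) * (G ^+ 2 * G `^ (p - 2)).
    rewrite powRM ?ltW// mulr_powRB1 ?ltW//; last lra.
    rewrite -powR_mulrn ?ltW// -powRD; last by rewrite (gt_eqF G0) implybT.
    by congr (_ * _ `^ _); lra.
  ring.
have H2 : 2 <= A `^ (p - 1) * G `^ (p - 2).
  rewrite EA -mulrA -powRM ?(ltW s0) ?(ltW G0)//.
  have : 1 <= (s * G) `^ (p - 2).
    apply: powR_ge1; first by lra.
    by move: Gs; rewrite ler_pdivrMr// mulrC; lra.
  have : (2 : R) <= 2 `^ (p - 1).
    rewrite -{1}(powRr1 (_ : 0 <= 2 :> R))//; apply: ler_powR; lra.
  by move=> H1 H3; rewrite -[leLHS]mulr1; apply: ler_pM.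
rewrite EG; have : 0 < A * G ^+ 2 by rewrite mulr_gt0// exprn_gt0.
have : A * X < A * G ^+ 2 by rewrite ltr_pM2l.
nra.
Qed.

Lemma sqn_halfspace_ge (x c : 'rV[R]_n.+1) (k : R) : 0 <= k -> xlast c = - k ->
  0 <= xlast x -> k ^+ 2 <= sqn (x - c).
Proof.
move=> k0 ck x0; apply: le_trans (coord_sqn (x - c) ord_max).
move: ck x0; rewrite /xlast !mxE => -> x0.
by rewrite opprK; nra.
Qed.

(** Here [s ^ 4] is the squared distance from the centre to the boundary. Hence in the half-space
    and for [t <= t0] the value is at most 1, and it is nonnegative only on a bounded set. *)
Definition log_arg (s t0 r t : R) := 1 - (r - s ^+ 4) / s ^+ 3 - (t0 - t) / s ^+ 3.

(** Otherwise [u - A ln f] has a negative minimum on a compact set [f >= e]. It is not on the flat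
    boundary, where [u = 0] and [ln f <= 0], nor on the face [f = e] if [e] is small; an interior
    minimum contradicts the strict subsolution property. *)
Lemma log_barrier_below u (x0 : 'rV[R]_n.+1) (t0 s : R) : 2 <= p ->
  ancient_solution p u -> 0 < xlast x0 -> t0 < 0 -> 1 <= s -> 2 * d + 1 < s ->
  let h := xlast x0 in let r0 := (h + s ^+ 2) ^+ 2 in
  1 / 2 <= log_arg s t0 r0 t0 ->
  2 * s `^ (1 - be) * ln (log_arg s t0 r0 t0) <= u x0 t0.
Proof.
move=> hp us x00 t00 s1 ds h r0 phi0; rewrite leNgt; apply/negP => uw.
have s0 : 0 < s by lra.
have s3 : 0 < s ^+ 3 by rewrite exprn_gt0.
have sn3 : s ^+ 3 != 0 by rewrite gt_eqF.
set A := 2 * s `^ (1 - be) in uw *.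
have A0 : 0 < A by rewrite mulr_gt0// powR_gt0.
pose c := x0 - (h + s ^+ 2) *: ebase R ord_max.
have cl : xlast c = - s ^+ 2.
  by rewrite /xlast !mxE !eqxx/= -/(xlast x0) -/h; ring.
have x0c : sqn (x0 - c) = r0.
  have -> : x0 - c = 0 + (h + s ^+ 2) *: ebase R ord_max by rewrite /c opprB addrC subrK add0r.
  by rewrite sqn_line sqn0 mxE /r0; ring.
pose f (z : point) := log_arg s t0 (sqn (z.1 - c)) z.2.
pose K e := [set z : point | [/\ 0 <= xlast z.1, z.2 <= t0 & e <= f z]].
have fc : continuous f.
  move=> z; rewrite /f /log_arg; apply: cvgB; first apply: cvgB.
  - exact: cvg_cst.
  - by apply: cvgM; [apply: cvgB; [exact: sqn1_continuous|exact: cvg_cst] | exact: cvg_cst].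
  - by apply: cvgM; [apply: cvgB; [exact: cvg_cst|exact: cvg_snd] | exact: cvg_cst].
have sqge (z : point) : 0 <= xlast z.1 -> s ^+ 4 <= sqn (z.1 - c).
  move=> z0; have := @sqn_halfspace_ge z.1 c (s ^+ 2) (sqr_ge0 _) cl z0.
  by rewrite -exprM.
have f1 e z : K e z -> f z <= 1.
  move=> [z0 zt _]; rewrite /f /log_arg; have := sqge z z0.
  move=> H; have : 0 <= (sqn (z.1 - c) - s ^+ 4) / s ^+ 3 by rewrite divr_ge0 ?(ltW s3) ?subr_ge0.
  have : 0 <= (t0 - z.2) / s ^+ 3 by rewrite divr_ge0 ?(ltW s3) ?subr_ge0.
  lra.
have cK e : 0 <= e -> compact (K e).
  move=> e0; apply: (subclosed_compact _ (@compact_cylinder R n c (s ^+ 4 + s ^+ 3) (t0 - s ^+ 3) t0)).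
    have -> : K e = [set z : point | 0 <= xlast z.1] `&` [set z : point | z.2 <= t0] `&` [set z : point | e <= f z].
      by apply/seteqP; split => z /=; [case|case; case].
    apply: closedI; first apply: closedI.
    - by apply: closed_le_fun; [exact: cst_continuous|exact: xlast1_continuous].
    - by apply: closed_le_fun; [move=> z; exact: cvg_snd|exact: cst_continuous].
    - by apply: closed_le_fun; [exact: cst_continuous|exact: fc].
  move=> z [z0 zt ef]; have H1 := sqge z z0.
  have H : 0 <= s ^+ 3 * f z by rewrite mulr_ge0 ?(ltW s3)// (le_trans e0).
  have E : s ^+ 3 * f z = s ^+ 3 - (sqn (z.1 - c) - s ^+ 4) - (t0 - z.2).
    by rewrite /f /log_arg; field; rewrite gt_eqF.
  by split; [lra | rewrite zt andbT; lra].
have KQ e : K e `<=` @Qclos R n by move=> z [z0 zt _]; split => //; lra.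
have Kx0 e : e <= 1 / 2 -> K e (x0, t0).
  by move=> e2; split => //=; [exact: ltW | rewrite /f /= x0c; lra].
have [z0 _ minu] := @comparison_min R n p u (K 0) (cst 0) us (cK 0 (lexx _))
   (ex_intro _ _ (Kx0 0 ltac:(lra))) (@KQ 0) (@continuous_subspaceT _ _ _ _ (@cst_continuous _ _ _)).
set m := unc u z0 in minu.
(* [m] is the minimum of [u] over [K 0]. Truncating where [A ln e <= m] makes [u - A ln f]
   nonnegative on the face [f = e], and [e <= 1 / 2] keeps [(x0, t0)] in [K e]. *)
pose e := Num.min (1 / 2) (expR (m / A)).
have e0 : 0 < e by rewrite lt_min expR_gt0 andbT; lra.
have e2 : e <= 1 / 2 by rewrite ge_min lexx.
have em : A * ln e <= m.
  rewrite mulrC -ler_pdivlMr// -[leRHS]expRK ler_ln ?posrE ?expR_gt0//.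
  by rewrite ge_min lexx orbT.
have cw : {within K e, continuous (fun z => A * ln (f z))}.
  apply: continuous_in_subspaceT => z; rewrite inE => -[_ _ ef].
  apply: cvgM; first exact: cvg_cst.
  by apply: continuous_cvg (fc z); apply: continuous_ln; exact: lt_le_trans ef.
have [z Kz minz] := comparison_min us (cK e (ltW e0)) (ex_intro _ _ (Kx0 e e2)) (@KQ e) cw.
have zneg : unc u z - A * ln (f z) < 0.
  apply: le_lt_trans (minz _ (Kx0 e e2)) _.
  by rewrite /unc /= /f /= x0c subr_lt0.
have [zx zt ef] := Kz.
have fz0 : 0 < f z by exact: lt_le_trans ef.
have zx0 : 0 < xlast z.1.
  rewrite lt_neqAle zx andbT; apply/negP => /eqP zx0.
  have [_ _ _ /(_ z.1 z.2)] := us; rewrite -zx0 => /(_ erefl (le_lt_trans zt t00)) uz.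
  move: zneg; rewrite /unc uz sub0r oppr_lt0 pmulr_rgt0// ltNge ln_le0//.
  exact: f1 Kz.
have efz : e < f z.
  rewrite lt_neqAle ef andbT; apply/negP => /eqP efz.
  have : m - 0 <= unc u z - 0.
    by apply: minu; split => //; exact: ltW.
  by move: zneg; rewrite -efz; lra.
have zt0 : z.2 < 0 by exact: le_lt_trans t00.
pose F r t := A * ln (log_arg s t0 r t).
pose F1 r := - (A / s ^+ 3) / log_arg s t0 r z.2.
pose r := sqn (z.1 - c).
have fzE : f z = log_arg s t0 r z.2 by [].
have dphi r' t' : is_derive (r' : R) 1 (fun r => log_arg s t0 r t') (- (s ^+ 3)^-1).
  by rewrite /log_arg; derive_rules; field; rewrite gt_eqF.
have D1 : \forall r' \near r, is_derive (r' : R) 1 (F^~ z.2) (F1 r').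
  have : \forall r' \near r, 0 < log_arg s t0 r' z.2.
    by have /cvgr_gt := is_derive_continuous (dphi r z.2); apply; rewrite -fzE.
  move=> pos; near=> r'; have r'0 : 0 < log_arg s t0 r' z.2 by near: r'.
  rewrite /F /F1.
  have H := dphi r' z.2; derive_rules; field; rewrite ?gt_eqF//.
have D2 : is_derive r 1 F1 (- (A / s ^+ 6) / (f z) ^+ 2).
  have H := dphi r z.2; rewrite /F1; derive_rules; first by rewrite -fzE gt_eqF.
  by rewrite -fzE; field; rewrite !gt_eqF.
have Dt : is_derive z.2 1 (F r) (A / s ^+ 3 / f z).
  have H : is_derive z.2 1 (log_arg s t0 r) ((s ^+ 3)^-1).
    by rewrite /log_arg; derive_rules; field; rewrite gt_eqF.
  have posr : 0 < log_arg s t0 r z.2 by rewrite -fzE.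
  by rewrite /F fzE; derive_rules; field; rewrite !gt_eqF.
have Hmin : \forall z' \near (z.1, z.2), z'.2 <= z.2 ->
     u z.1 z.2 - F (sqn (z.1 - c)) z.2 <= u z'.1 z'.2 - F (sqn (z'.1 - c)) z'.2.
  near=> z' => z't.
  apply: (minz z'); split.
  - by apply: ltW; near: z'; exact: (cvgr_gt _ (@xlast1_continuous R n (z.1, z.2)) _ zx0).
  - exact: le_trans z't zt.
  - by apply: ltW; near: z'; exact: (cvgr_gt _ (fc (z.1, z.2)) _ efz).
have := radial_comparison us zx0 zt0 D1 D2 Dt Hmin.
apply/negP; rewrite -/r -ltNge.
pose G := 2 * Num.sqrt r / (s ^+ 3 * f z).
have r4 : s ^+ 4 <= r by exact: sqge.
have sr : Num.sqrt r ^+ 2 = r by rewrite sqr_sqrtr// (le_trans _ r4)// exprn_ge0// ltW.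
have srs : s ^+ 2 <= Num.sqrt r.
  by rewrite -(ger0_norm (sqr_ge0 s)) -sqrtr_sqr ler_sqrt ?(le_trans _ r4) ?exprn_ge0 ?(ltW s0)// -exprM.
have fz1 : f z <= 1 by exact: f1 Kz.
have -> : 2 * Num.sqrt r * `|F1 r| = A * G.
  rewrite /F1 -fzE mulNr normrN ger0_norm; last by rewrite !divr_ge0 ?ltW.
  by rewrite /G; field; rewrite !gt_eqF.
have EG : G ^+ 2 = 4 * r / (s ^+ 3 * f z) ^+ 2.
  by rewrite /G expr_div_n exprMn sr; congr (_ * _ / _); ring.
(* The time derivative contributes the [1] in [2 d + 1]; the two parts of the Laplacian contribute
   [2 d] and [G ^ 2]. *)
have -> : A / s ^+ 3 / f z - (2 * d * F1 r + 4 * r * (- (A / s ^+ 6) / f z ^+ 2)) =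
    A * ((2 * d + 1) / (s ^+ 3 * f z) + G ^+ 2).
  by rewrite EG /F1 -fzE; field; rewrite !gt_eqF.
apply: (log_barrier_num s1 _ _ hp (erefl A)).
  rewrite /G ler_pdivlMr ?mulr_gt0// mulrAC ler_pdivrMr//.
  have : s ^+ 3 * f z <= s ^+ 3 by rewrite ler_piMr ?(ltW s3).
  have : s ^+ 3 <= Num.sqrt r * s by rewrite exprSr ler_pM2r.
  lra.
(* What remains is [(2 d + 1) f < 4 r / s ^ 3], which follows from [f <= 1], [2 d + 1 < s] and
   [r >= s ^ 4]. *)
have -> : G ^+ 2 = (4 * r / s ^+ 3 / f z) / (s ^+ 3 * f z).
  by rewrite EG; field; rewrite !gt_eqF.
rewrite ltr_pM2r ?invr_gt0 ?mulr_gt0// ltr_pdivlMr// ltr_pdivlMr//.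
have s43 : s ^+ 4 = s * s ^+ 3 by rewrite exprS.
have Hd : (2 * d + 1) * f z <= 2 * d + 1 by rewrite ler_piMr// addr_ge0 ?mulr_ge0.
apply: (@lt_le_trans _ _ (s * s ^+ 3)); last by move: r4; rewrite s43; have := mulr_gt0 s0 s3; lra.
by rewrite ltr_pM2r//; lra.
Unshelve. all: by end_near.
Qed.

(** At a fixed point the argument of the logarithm is [1 - e] with [e <= k / s], so
    [log_barrier_below] bounds [u] from below by [- 4 k / s ^ be], which tends to 0 as [s] grows. *)
Theorem ancient_nonneg u : 2 <= p -> ancient_solution p u ->
  forall (x : 'rV[R]_n.+1) t, 0 < xlast x -> t < 0 -> 0 <= u x t.
Proof.
move=> hp us x t x0 t0; rewrite leNgt; apply/negP => u0.
set h := xlast x in x0.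
pose k := h ^+ 2 + 2 * h.
have k0 : 0 < k by rewrite /k; nra.
pose B := 4 * k / - u x t.
have B0 : 0 < B by rewrite divr_gt0 ?mulr_gt0 ?oppr_gt0.
(* The summands secure in turn [2 d + 1 < s], the bound [k / s <= 1 / 2], and [s ^ be > B]. *)
pose s := 2 * d + 2 + 2 * k + B `^ (p - 1).
have Bp : 0 < B `^ (p - 1) by rewrite powR_gt0.
have dge : (1 : R) <= d by rewrite ler1n.
have s1 : 1 <= s by rewrite /s; lra.
have s0 : 0 < s by lra.
have ds : 2 * d + 1 < s by rewrite /s; lra.
pose e := (h ^+ 2 + 2 * s ^+ 2 * h) / s ^+ 3.
have E : log_arg s t ((h + s ^+ 2) ^+ 2) t = 1 - e.
  by rewrite /log_arg /e; field; rewrite gt_eqF.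
have ek : e <= k / s.
  rewrite /e ler_pdivrMr ?exprn_gt0// (_ : k / s * s ^+ 3 = k * s ^+ 2); last first.
    by field; rewrite gt_eqF.
  rewrite /k; have : 1 <= s ^+ 2 by rewrite expr_ge1// ltW.
  have : 0 <= h ^+ 2 by exact: sqr_ge0.
  nra.
have e2 : e <= 1 / 2.
  apply: le_trans ek _; rewrite ler_pdivrMr// /s; lra.
have e0 : 0 < e by rewrite divr_gt0 ?exprn_gt0// addr_gt0 ?exprn_gt0// !mulr_gt0// exprn_gt0.
have he : 1 / 2 <= 1 - e by lra.
have := @log_barrier_below u x t s hp us x0 t0 s1 ds; rewrite -/h /= E => /(_ he).
apply/negP; rewrite -ltNge.
have lne : - (2 * e) <= ln (1 - e).
  have -> : 1 - e = ((1 - e)^-1)^-1 by rewrite invrK.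
  rewrite lnV ?posrE ?invr_gt0; last lra.
  rewrite lerN2 (_ : (1 - e)^-1 = 1 + e / (1 - e)); last by field; rewrite gt_eqF//; lra.
  have e1 : 0 < 1 - e by lra.
  apply: le_trans (le_ln1Dx _) _; first by apply: lt_le_trans (_ : -1 < 0) (divr_ge0 _ _); lra.
  by rewrite ler_pdivrMr//; nra.
have sa : s `^ (1 - be) = s / s `^ be.
  by rewrite powRB ?powRr1 ?ltW// (gt_eqF s0) implybT.
have sb : B < s `^ be.
  have p1 : p - 1 != 0 by rewrite gt_eqF//; lra.
  have -> : B = (B `^ (p - 1)) `^ be by rewrite -powRrM mulfV// powRr1// ltW.
  apply: gt0_ltr_powR; rewrite ?invr_gt0 ?nnegrE ?powR_ge0 ?ltW//; first lra.
  by rewrite /s; lra.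
have sb0 : 0 < s `^ be by exact: powR_gt0.
apply: lt_le_trans (_ : - (2 * s `^ (1 - be) * (2 * (k / s))) <= _); last first.
  have := powR_gt0 (1 - be) s0 => sap.
  rewrite -mulrN ler_pM2l ?mulr_gt0//; lra.
rewrite sa (_ : 2 * (s / s `^ be) * (2 * (k / s)) = 4 * k / s `^ be); last first.
  by field; rewrite !gt_eqF.
rewrite ltrNr ltr_pdivrMr//.
by move: sb; rewrite /B ltr_pdivrMr ?oppr_gt0// [X in _ < X]mulrC.
Qed.

End Nonneg.

(** * Upper bound *)

Section Powers.
Variable R : realType.
Implicit Types a b p r : R.

(** Write [a ^ p] as [a] times [a ^ (p - 1)] and enlarge the second factor to [(a + b) ^ (p - 1)];
    likewise for [b]. *)
Lemma powR_superadd a b p : 1 <= p -> 0 <= a -> 0 <= b -> a `^ p + b `^ p <= (a + b) `^ p.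
Proof.
move=> p1 a0 b0; have p0 : 0 < p by lra.
rewrite -(mulr_powRB1 a0 p0) -(mulr_powRB1 b0 p0) -(mulr_powRB1 (addr_ge0 a0 b0) p0) mulrDl.
by apply: lerD; apply: ler_wpM2l => //; apply: powR_le; lra.
Qed.

(** The infinite slope of [r ^ a] at 0 in quantitative form: [r <= (2 k) ^ (- 1 / (1 - a))] gives
    [k r <= r ^ a / 2]. *)
Lemma powR_sublinear a b (k : R) : 0 < a < 1 -> 0 < b -> 0 < k ->
  exists2 r, 0 < r < b & k * r < r `^ a.
Proof.
move=> /andP[a0 a1] b0 k0; pose c := (2 * k)^-1 `^ (1 - a)^-1.
have c0 : 0 < c by rewrite powR_gt0// invr_gt0; lra.
pose r := Num.min (b / 2) c.
have r0 : 0 < r by rewrite lt_min c0 andbT; lra.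
exists r; first by rewrite r0 gt_min; apply/orP; left; lra.
have rc : r `^ (1 - a) <= (2 * k)^-1.
  have -> : (2 * k)^-1 = c `^ (1 - a).
    by rewrite -powRrM mulVf ?powRr1 ?gt_eqF ?invr_ge0; lra.
  by apply: powR_le; [lra|exact: ltW|rewrite ge_min lexx orbT].
have -> : k * r = k * r `^ (1 - a) * r `^ a.
  by rewrite -mulrA -powRD ?(gt_eqF r0) ?implybT// subrK powRr1 ?(ltW r0).
rewrite -[ltRHS]mul1r ltr_pM2r ?powR_gt0//.
move: rc; rewrite -(ler_pM2l k0); have -> : k * (2 * k)^-1 = 2^-1 by field; rewrite gt_eqF.
lra.
Qed.

(** The absolute value extends the power continuously to the whole line, so the cap can be treated
    as continuous across the sphere. *)
Lemma norm_powR_continuous a : 0 < a -> continuous (fun x : R => `|x| `^ a).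
Proof.
move=> a0 x; have [->|x0] := eqVneq x 0; last first.
  apply: (@continuous_comp _ _ _ (fun x : R => `|x|) (fun y => y `^ a)).
    exact: norm_continuous.
  by apply: is_derive_continuous; apply: is_derive1_powR; rewrite normr_gt0.
rewrite /continuous_at normr0 powR0 ?gt_eqF//.
apply/cvgrPdist_lt => e e0; near=> y.
rewrite sub0r normrN ger0_norm ?powR_ge0//.
have -> : e = (e `^ a^-1) `^ a by rewrite -powRrM mulVf ?powRr1 ?gt_eqF// ltW.
apply: gt0_ltr_powR; rewrite ?nnegrE ?powR_ge0//.
near: y; have /cvgrPdist_lt := (@cvg_id _ (nbhs (0 : R))).
move=> /(_ (e `^ a^-1)); rewrite powR_gt0// => /(_ isT).
by apply: filterS => y; rewrite sub0r normrN.
Unshelve. all: by end_near.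
Qed.

End Powers.

(** * The spike and cap barriers *)

Section Barrier.
Variables (R : realType) (n : nat) (p : R).
Notation d := (n.+1%:R : R).
Notation be := ((p - 1)^-1).

(** The identity [be p = 1 + be] balances the equation: the [p]-th power of a gradient of order
    [T ^ (- be)] has the order [T ^ (- be - 1)] of its time derivative. *)
Lemma conj_exp : 2 < p -> 0 < be < 1 /\ be * p = 1 + be.
Proof.
move=> hp; have p1 : 0 < p - 1 by lra.
rewrite invr_gt0 p1 invf_lt1//; split; first by lra.
by field; rewrite gt_eqF.
Qed.

(** With [m = (1 + be) / 2], the constants satisfy [spike_const (1 - m) = 2 d + 1] and
    [cap_slope (1 - be) = 2 d + 4], the coefficients that appear after differentiation. [cap_drift]
    exceeds [4 (2 d + 4) ^ 2], the size of the cap terms for [r < 1 / 2]. *)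
Definition spike_const : R := 2 * (2 * d + 1) / (1 - be).
Definition cap_slope : R := (2 * d + 4) / (1 - be).
Definition cap_drift : R := 4 * (2 * d + 4) ^+ 2 + 1.

(* [spike_barrier] concentrates at the centre as [t] decreases to [t1]; [cap_barrier] has infinite slope on the sphere [r = 1]. *)
Definition spike_barrier (T t1 r t : R) :=
  T `^ (- be) * (((t - t1) / T) `^ (- ((1 + be) / 2)) * (r + spike_const * ((t - t1) / T))).
Definition cap_barrier (t1 r t : R) := cap_slope * (1 - (1 - r) `^ (1 - be)) + cap_drift * (t - t1).

(** With [z = r / s], the exponents of the spike turn the right side into
    [2 ^ p (a / T) z ^ (p / 2)]. Since [T <= 1], the Laplacian uses up [2 d] of [2 d + 1], and what
    is left is [(1 + be) / 2 z - 1 <= z ^ (p / 2)]. *)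
Lemma spike_num (T s r a : R) : 2 < p -> 0 < T <= 1 -> 0 < s -> 0 <= r ->
  a = T `^ (- be) * s `^ (- ((1 + be) / 2)) ->
  a / T * ((1 + be) / 2 * (r / s) - (2 * d + 1)) + 2 * d * a <= (2 * Num.sqrt r * a) `^ p.
Proof.
move=> hp /andP[T0 T1] s0 r0 aE.
have [/andP[b0 b1] bp] := conj_exp hp.
have a0 : 0 < a by rewrite aE mulr_gt0 ?powR_gt0.
have dge : (1 : R) <= d by rewrite ler1n.
have aT : a <= a / T by rewrite ler_pdivlMr// ler_piMr ?(ltW a0).
have aT0 : 0 < a / T by rewrite divr_gt0.
set z := r / s; have z0 : 0 <= z by rewrite divr_ge0// ltW.
have ap : a `^ p = a / T * s `^ (- (p / 2)).
  rewrite aE powRM ?powR_ge0// -!powRrM.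
  have -> : - be * p = - be + - 1 by rewrite mulNr bp; lra.
  have -> : - ((1 + be) / 2) * p = - ((1 + be) / 2) + - (p / 2) by lra.
  rewrite !powRD ?(gt_eqF T0) ?(gt_eqF s0) ?implybT// powR_inv1 ?(ltW T0)//.
  by ring.
have -> : (2 * Num.sqrt r * a) `^ p = 2 `^ p * (a / T * z `^ (p / 2)).
  rewrite powRM ?mulr_ge0 ?sqrtr_ge0 ?(ltW a0)// powRM ?sqrtr_ge0// ap.
  rewrite -powR12_sqrt// -powRrM (mulrC _ p) /z powRM ?invr_ge0 ?(ltW s0)//.
  have -> : s^-1 = s `^ (-1) by rewrite powR_inv1 ?(ltW s0).
  by rewrite -powRrM mulN1r; ring.
have p2 : 1 <= 2 `^ p by apply: powR_ge1; lra.
have zp : (1 + be) / 2 * z - 1 <= z `^ (p / 2).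
  have zp0 := powR_ge0 z (p / 2).
  have [z1|z1] := leP z 1; first by nra.
  have : z <= z `^ (p / 2) by apply: le1r_powR; [exact: ltW | lra].
  nra.
apply: (@le_trans _ _ (a / T * ((1 + be) / 2 * z - 1))).
  have : 2 * d * a <= 2 * d * (a / T) by rewrite ler_pM2l//; lra.
  rewrite -/z; lra.
apply: (@le_trans _ _ (a / T * z `^ (p / 2))); first by rewrite ler_pM2l.
by rewrite ler_peMl// mulr_ge0 ?powR_ge0// ltW.
Qed.

(** [D ^ p = (1 - r) ^ (- be - 1)] has the order of the second derivative of the cap. For
    [r >= 1 / 2] the gradient term dominates; for smaller [r], where the gradient may vanish, all
    other terms are bounded and the drift dominates. *)
Lemma cap_num (r N D : R) : 2 < p -> 0 <= r < 1 ->
  N = 2 * d + 4 -> D = (1 - r) `^ (- be) ->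
  - cap_drift + 2 * d * (N * D) + 4 * r * (N * be * (1 - r) `^ (- be - 1)) <
  (2 * Num.sqrt r * (N * D)) `^ p.
Proof.
move=> hp /andP[r0 r1] NE DE.
have [/andP[b0 b1] bp] := conj_exp hp.
have dge : (1 : R) <= d by rewrite ler1n.
have N1 : 1 <= N by rewrite NE; lra.
have N0 : 0 < N by lra.
have s0 : 0 < 1 - r by lra.
have D0 : 0 < D by rewrite DE powR_gt0.
set D' := (1 - r) `^ (- be - 1).
have DD' : D <= D'.
  by rewrite DE; apply: ger_powR; [apply/andP; split; lra | lra].
have Dp : D `^ p = D'.
  by rewrite DE -powRrM; congr (_ `^ _); rewrite mulNr bp; lra.
have lhs : - cap_drift + 2 * d * (N * D) + 4 * r * (N * be * D') <= - cap_drift + N ^+ 2 * D'.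
  have H1 : 2 * d * (N * D) <= 2 * d * (N * D').
    by rewrite ler_pM2l ?ler_pM2l//; lra.
  have H2 : r * be <= 1 by nra.
  have ND : 0 < N * D' by rewrite mulr_gt0// (lt_le_trans D0).
  have H3 : 4 * r * (N * be * D') <= 4 * (N * D').
    have -> : 4 * r * (N * be * D') = 4 * ((r * be) * (N * D')) by ring.
    by rewrite ler_pM2l// ler_piMl// ltW.
  have -> : N ^+ 2 * D' = 2 * d * (N * D') + 4 * (N * D') by rewrite NE; ring.
  lra.
apply: le_lt_trans lhs _.
have [r2|r2] := leP (1 / 2) r.
  apply: (@lt_le_trans _ _ (N ^+ 2 * D')).
    by rewrite /cap_drift; have := sqr_ge0 (2 * d + 4); lra.
  rewrite powRM ?mulr_ge0 ?sqrtr_ge0 ?(ltW N0) ?(ltW D0)// powRM ?(ltW N0) ?(ltW D0)// Dp.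
  have S1 : 1 <= (2 * Num.sqrt r) `^ p.
    apply: powR_ge1; first by lra.
    have S0 : Num.sqrt ((1 / 2) ^+ 2) <= Num.sqrt r by rewrite ler_sqrt//; nra.
    move: S0; rewrite sqrtr_sqr ger0_norm; lra.
  have S2 : N ^+ 2 <= N `^ p.
    by rewrite -powR_mulrn ?(ltW N0)//; apply: ler_powR => //; lra.
  have D'0 : 0 < D' by exact: lt_le_trans DD'.
  apply: (@le_trans _ _ (N `^ p * D')); first by rewrite ler_pM2r.
  by rewrite ler_peMl// mulr_ge0 ?powR_ge0// ltW.
apply: lt_le_trans (powR_ge0 _ _).
have D4 : D' <= 4.
  have -> : D' = ((1 - r)^-1) `^ (1 + be).
    rewrite -powR_inv1 ?(ltW s0)// -powRrM; congr (_ `^ _); lra.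
  have i2 : (1 - r)^-1 <= 2 by rewrite -[2]invrK lef_pV2 ?posrE ?invr_gt0//; lra.
  apply: (@le_trans _ _ (2 `^ (1 + be))).
    by apply: powR_le; rewrite ?invr_ge0; lra.
  apply: (@le_trans _ _ (2 `^ 2)); first by apply: ler_powR; lra.
  by rewrite (powR_mulrn 2)//; lra.
have : N ^+ 2 * D' <= N ^+ 2 * 4 by rewrite ler_pM2l// exprn_gt0.
by rewrite /cap_drift -NE; lra.
Qed.

End Barrier.

(** * Calculus of the barriers and their behaviour on the sphere *)

Section Upper.
Variables (R : realType) (n : nat) (p : R).
Notation point := ('rV[R]_n.+1 * R)%type.
Notation d := (n.+1%:R : R).
Notation be := ((p - 1)^-1).
Notation spike := (@spike_barrier R n p).
Notation cap := (@cap_barrier R n p).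
Notation kap := (@spike_const R n p).
Notation Cb := (@cap_slope R n p).
Notation Ct := (@cap_drift R n).

Lemma barrier_consts : 2 < p -> [/\ 0 < kap, 0 < Cb & 0 < Ct].
Proof.
move=> hp; have [/andP[b0 b1] _] := conj_exp hp.
have dge : (1 : R) <= d by rewrite ler1n.
split; rewrite /spike_const /cap_slope /cap_drift.
- by apply: divr_gt0; lra.
- by apply: divr_gt0; lra.
- by have := sqr_ge0 (2 * d + 4); lra.
Qed.

Lemma spike_ge (T t1 r t : R) : 2 < p -> 0 < T -> t1 < t -> 0 <= r ->
  T `^ (- be) * (((t - t1) / T) `^ (- ((1 + be) / 2)) * r) <= spike T t1 r t.
Proof.
move=> hp T0 tt1 r0; have [k0 _ _] := barrier_consts hp.
rewrite /spike_barrier ler_pM2l ?powR_gt0// ler_pM2l ?powR_gt0 ?divr_gt0 ?subr_gt0//.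
by rewrite lerDl mulr_ge0 ?(ltW k0)// divr_ge0 ?(ltW T0)// subr_ge0 ltW.
Qed.

Lemma cap_ge0 (t1 r t : R) : 2 < p -> t1 <= t -> 0 <= r <= 1 -> 0 <= cap t1 r t.
Proof.
move=> hp tt1 /andP[r0 r1]; have [/andP[b0 b1] _] := conj_exp hp.
have [_ c0 ct0] := barrier_consts hp.
rewrite /cap_barrier; apply: addr_ge0; apply: mulr_ge0; rewrite ?(ltW c0) ?(ltW ct0) ?subr_ge0//.
rewrite -[leRHS](_ : 1 `^ (1 - be) = 1); last by rewrite powR1.
by apply: powR_le; lra.
Qed.

Lemma barrier_derivs (M T t1 r t : R) : 2 < p -> 0 < T -> t1 < t -> r < 1 ->
  let F r t := M - spike T t1 r t - cap t1 r t in
  let a := T `^ (- be) * ((t - t1) / T) `^ (- ((1 + be) / 2)) in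
  let F1 r := - (a + (2 * d + 4) * (1 - r) `^ (- be)) in
  [/\ \forall r' \near r, is_derive (r' : R) 1 (F^~ t) (F1 r'),
      is_derive r 1 F1 (- ((2 * d + 4) * be * (1 - r) `^ (- be - 1))) &
      is_derive t 1 (F r)
       (a / T * ((1 + be) / 2 * (r / ((t - t1) / T)) - (2 * d + 1)) - Ct)].
Proof.
move=> hp T0 tt1 r1 F a F1; have [/andP[b0 b1] _] := conj_exp hp.
have s0 : 0 < (t - t1) / T by rewrite divr_gt0// subr_gt0.
have al : 1 - be != 0 by rewrite gt_eqF//; lra.
split.
- near=> r'; have r'1 : 0 < 1 - r' by rewrite subr_gt0; near: r'; exact: lt_nbhsl.
  rewrite /F /F1 /spike_barrier /cap_barrier /a; derive_rules.
  rewrite (_ : 1 - be - 1 = - be); last by lra.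
  have <- : Cb * (1 - be) = 2 * d + 4 by rewrite /cap_slope divfK.
  by ring.
- have r'1 : 0 < 1 - r by lra.
  by rewrite /F1; derive_rules; ring.
- rewrite /F /spike_barrier /cap_barrier.
  have D : is_derive t 1 (fun t => (t - t1) / T) T^-1 by derive_rules; ring.
  derive_rules.
  set m := (1 + be) / 2; set s := (t - t1) / T in s0 *.
  have -> : s `^ (- m - 1) = s `^ (- m) / s.
    by rewrite powRD ?(gt_eqF s0) ?implybT// powR_inv1// ltW.
  rewrite /a -/s /spike_const (_ : 1 - be = 2 * (1 - m)); last by rewrite /m; lra.
  have m1 : 1 - m != 0 by rewrite gt_eqF// /m; lra.
  by field; rewrite ?m1 ?(gt_eqF s0) ?(gt_eqF T0).
Unshelve. all: by end_near.
Qed.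

Lemma barrier_continuous (M T t1 dl : R) (c : 'rV[R]_n.+1) : 2 < p -> 0 < T -> 0 < dl ->
  {within [set z : point | sqn (z.1 - c) <= 1 /\ t1 + dl <= z.2 <= t1 + T],
    continuous (fun z => M - spike T t1 (sqn (z.1 - c)) z.2 -
      (Cb * (1 - `|1 - sqn (z.1 - c)| `^ (1 - be)) + Ct * (z.2 - t1)))}.
Proof.
move=> hp T0 dl0; have [/andP[b0 b1] _] := conj_exp hp.
apply: continuous_in_subspaceT => z; rewrite inE => -[/= _ /andP[zt _]].
have cs := @sqn1_continuous R n c z.
have ct : (fun z : point => (z.2 - t1)) @ z --> z.2 - t1.
  by apply: cvgB; [exact: cvg_snd | exact: cvg_cst].
have ctT : (fun z : point => (z.2 - t1) / T) @ z --> (z.2 - t1) / T.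
  by apply: cvgM; [exact: ct | exact: cvg_cst].
have s0 : 0 < (z.2 - t1) / T by rewrite divr_gt0//; lra.
rewrite /spike_barrier; apply: cvgB; first apply: cvgB.
- exact: cvg_cst.
- apply: cvgM; first exact: cvg_cst.
  apply: cvgM.
    apply: (@continuous_cvg _ _ _ _ _ _ (fun y => y `^ (- ((1 + be) / 2)))) ctT.
    by apply: is_derive_continuous; exact: is_derive1_powR.
  by apply: cvgD; [exact: cs | apply: cvgM; [exact: cvg_cst | exact: ctT]].
- apply: cvgD; apply: cvgM; [exact: cvg_cst | | exact: cvg_cst | exact: ct].
  apply: cvgB; first exact: cvg_cst.
  apply: (@continuous_cvg _ _ _ _ _ _ (fun y => `|y| `^ (1 - be))).
    by apply: norm_powR_continuous; lra.
  by apply: cvgB; [exact: cvg_cst | exact: cs].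
Qed.

Lemma near_center u (x0 : 'rV[R]_n.+1) (t1 M : R) : ancient_solution p u ->
  0 < xlast x0 -> t1 < 0 -> M < u x0 t1 ->
  exists2 k, 0 < k & forall x t, sqn (x - x0) < k ^+ 2 -> `|t - t1| < k -> M < u x t.
Proof.
move=> [uC _ _ _] x00 t10 Mu.
have [|_ [cu _ _ _]] := uC (x0, t1) => //.
have : \forall z \near (x0, t1), M < unc u z by exact: (cvgr_gt _ cu _ Mu).
move=> /nbhs_ballP[k /= k0 H]; exists k => // x t xk tk.
apply: (H (x, t)); split => /=; last by rewrite /ball/= distrC.
split => // i j; rewrite /ball/= distrC (ord1 i) -sqrtr_sqr -(ger0_norm (ltW k0)) -sqrtr_sqr.
rewrite ltr_sqrt ?exprn_gt0//; apply: le_lt_trans xk.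
by have := coord_sqn (x - x0) j; rewrite !mxE.
Qed.

(* The quotients of [u] stay bounded while the barrier has infinite slope at the sphere. *)
Lemma no_min_on_sphere u (c : 'rV[R]_n.+1) (z : point) (w : R -> R) :
  2 < p -> ancient_solution p u -> 0 < xlast z.1 -> z.2 < 0 -> sqn (z.1 - c) = 1 ->
  (forall r, 0 <= r <= 1 -> Cb * (1 - r) `^ (1 - be) <= w r - w 1) ->
  (forall x, sqn (x - c) <= 1 -> u z.1 z.2 - w 1 <= u x z.2 - w (sqn (x - c))) ->
  False.
Proof.
move=> hp us z0 zt sz ww minz; have [/andP[b0 b1] _] := conj_exp hp.
have [_ c0 _] := barrier_consts hp.
set y := z.1 - c in sz.
have [i yi0] : exists i, y 0 i != 0.
  apply/existsP; rewrite -negb_forall; apply/negP => /forallP H.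
  have : sqn y = 0 by rewrite /sqn big1// => i _; rewrite (eqP (H i)) expr0n.
  by rewrite sz; move=> /eqP; rewrite oner_eq0.
pose Y := `|y 0 i|; have Y0 : 0 < Y by rewrite normr_gt0.
have Y1 : Y <= 1.
  have := coord_sqn y i; rewrite sz -(real_normK (num_real _)) -/Y => YY.
  by rewrite -(@expr_le1 _ 2)// ltW.
pose sg := Num.sg (y 0 i).
have sgY : y 0 i = sg * Y by rewrite /sg /Y -numEsg.
have sg1 : sg ^+ 2 = 1 by rewrite /sg sqr_sg yi0.
have nsg : `|sg| = 1 by rewrite normr_sg yi0.
have [uC _ _ _] := us.
have D0 : `|0 : R| < xlast z.1 by rewrite normr0.
have D := C21_line i uC zt D0.
have [d' d'0 Hd] := is_derive_eps D ltr01.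
set g := pdx i u _ _ in D Hd.
pose K1 := `|g| + 1; have K10 : 0 < K1 by rewrite ltr_wpDl.
have CY : 0 < Cb * Y `^ (1 - be) by rewrite mulr_gt0// powR_gt0.
have al : 0 < 1 - be < 1 by apply/andP; split; lra.
have mn : 0 < Num.min d' Y by rewrite lt_min d'0.
(* An inward step of length [r < Y] along coordinate [i] lowers the squared distance by at least
   [Y r]. It raises [u] by at most [K1 r], and [r] is so small that the gain [Cb (Y r) ^ (1 - be)]
   of the barrier is larger. *)
have [r /andP[r0 rlt] Hr] := powR_sublinear al mn (divr_gt0 K10 CY).
move: rlt; rewrite lt_min => /andP[rd rY].
have E : sqn (z.1 + (- (sg * r)) *: ebase R i - c) = 1 - (2 * Y * r - r ^+ 2).
  rewrite addrAC sqn_line -/y sz sgY.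
  have -> : 1 + 2 * - (sg * r) * (sg * Y) + (- (sg * r)) ^+ 2 = 1 - sg ^+ 2 * (2 * Y * r - r ^+ 2) by ring.
  by rewrite sg1 mul1r.
have Yr : Y * r <= 2 * Y * r - r ^+ 2 by nra.
have Yr1 : 2 * Y * r - r ^+ 2 <= 1 by nra.
have Yr0 : 0 < Y * r by rewrite mulr_gt0.
have := minz (z.1 + (- (sg * r)) *: ebase R i); rewrite E.
have -> : 1 - (2 * Y * r - r ^+ 2) <= 1 = true by apply/idP; lra.
move=> /(_ isT) H1.
have := ww (1 - (2 * Y * r - r ^+ 2)).
have -> : 0 <= 1 - (2 * Y * r - r ^+ 2) <= 1 = true by apply/andP; split; lra.
move=> /(_ isT); rewrite subKr => H2.
have := Hd (- (sg * r)); rewrite normrN normrM nsg mul1r (gtr0_norm r0) => /(_ rd).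
rewrite add0r scale0r addr0 mul1r ler_norml => /andP[_ H3].
have H4 : - (g * (sg * r)) <= `|g| * r.
  apply: le_trans (ler_norm _) _; rewrite normrN !normrM nsg mul1r (gtr0_norm r0)//.
have H5 : Cb * (Y * r) `^ (1 - be) <= K1 * r.
  have : Cb * (Y * r) `^ (1 - be) <= Cb * (2 * Y * r - r ^+ 2) `^ (1 - be).
    by rewrite ler_pM2l//; apply: powR_le => //; lra.
  rewrite /K1; lra.
move: Hr; rewrite mulrAC ltr_pdivrMr// => Hr.
move: H5; rewrite powRM ?(ltW Y0) ?(ltW r0)// => H5.
have := powR_ge0 r (1 - be); lra.
Qed.

End Upper.

(** * The upper bound at unit height *)

Section UpperBound.
Variables (R : realType) (n : nat) (p : R).
Notation point := ('rV[R]_n.+1 * R)%type.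
Notation d := (n.+1%:R : R).
Notation be := ((p - 1)^-1).
Notation spike := (@spike_barrier R n p).
Notation cap := (@cap_barrier R n p).
Notation kap := (@spike_const R n p).
Notation Cb := (@cap_slope R n p).
Notation Ct := (@cap_drift R n).

Lemma barrier_sum (A1 ct k v ND G H P Q : R) : A1 + k * v <= P -> - ct + k * ND + H * G < Q ->
  A1 - ct - (k * - (v + ND) + H * - G) < P + Q.
Proof. lra. Qed.

(** If the bound fails, pick [M] strictly between its two sides. Then [u - w] with
    [w = M - spike - cap] is negative at the lowest point of the unit ball at time [t1 + T], while
    its minimum over the cylinder can lie neither on the initial face, nor on the sphere, nor
    inside. *)
Lemma boundary_descent u (x0 : 'rV[R]_n.+1) (t1 T : R) : 2 < p -> ancient_solution p u ->
  1 < xlast x0 -> 0 < T <= 1 -> t1 + T < 0 ->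
  u x0 t1 <= u (x0 - ebase R ord_max) (t1 + T) + (T `^ (- be) * (1 + kap) + Cb + Ct).
Proof.
move=> hp us x01 /andP[T0 T1] t1T; rewrite leNgt; apply/negP => ulow.
have [/andP[b0 b1] bp] := conj_exp hp.
have p1 : 1 <= p by lra.
have [k0 c0 ct0] := barrier_consts n hp.
set q := T `^ (- be) in ulow.
have q0 : 0 < q by rewrite powR_gt0.
set W := u (x0 - _) _ + _ in ulow.
pose M := (W + u x0 t1) / 2.
have WM : W < M by rewrite /M; lra.
have Mu : M < u x0 t1 by rewrite /M; lra.
have t10 : t1 < 0 by lra.
have x00 : 0 < xlast x0 by lra.
have [k kp Hk] := near_center us x00 t10 Mu.
pose m := (1 + be) / 2; have m0 : 0 < m by rewrite /m; lra.
pose j := q * k ^+ 2 / (`|M| + 1).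
have M1 : 0 < `|M| + 1 by rewrite ltr_wpDl.
have j0 : 0 < j by rewrite divr_gt0// mulr_gt0// exprn_gt0.
(* The cylinder starts at [t1 + dl]: [dl < k] keeps [u > M] near the centre, and [(dl / T) ^ m <= j]
   makes the spike at least [|M| + 1] at distance [k] or more. *)
pose dl := Num.min (k / 2) (T * Num.min (1 / 2) (j `^ m^-1)).
have h0 : 0 < Num.min (1 / 2) (j `^ m^-1) by rewrite lt_min powR_gt0// andbT; lra.
have dl0 : 0 < dl by rewrite lt_min divr_gt0//= mulr_gt0.
have dlk : dl < k by rewrite gt_min; apply/orP; left; lra.
have dlTmin : dl / T <= Num.min (1 / 2) (j `^ m^-1).
  by rewrite ler_pdivrMr// mulrC ge_min lexx orbT.
have dlT : dl < T.
  by move: dlTmin; rewrite le_min ler_pdivrMr// => /andP[+ _]; lra.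
have sj : (dl / T) `^ m <= j.
  have -> : j = (j `^ m^-1) `^ m by rewrite -powRrM mulVf ?powRr1 ?(ltW j0)// gt_eqF.
  apply: powR_le; rewrite ?(ltW m0)//; first by rewrite divr_ge0 ?(ltW T0) ?(ltW dl0).
  by move: dlTmin; rewrite le_min => /andP[].
pose K := [set z : point | sqn (z.1 - x0) <= 1 /\ t1 + dl <= z.2 <= t1 + T].
pose w (z : point) := M - spike T t1 (sqn (z.1 - x0)) z.2 -
   (Cb * (1 - `|1 - sqn (z.1 - x0)| `^ (1 - be)) + Ct * (z.2 - t1)).
pose F r t := M - spike T t1 r t - cap t1 r t.
have wF z : sqn (z.1 - x0) <= 1 -> w z = F (sqn (z.1 - x0)) z.2.
  by move=> z1; rewrite /w /F /cap_barrier ger0_norm// subr_ge0.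
have Kx z : K z -> 0 < xlast z.1.
  move=> [z1 _]; have := coord_sqn (z.1 - x0) ord_max; rewrite /xlast !mxE in x01 *.
  by move=> /le_trans/(_ z1); nra.
have Kt z : K z -> z.2 < 0 by move=> [_ /andP[_ zt]]; lra.
have KQ : K `<=` @Qclos R n by move=> z Kz; split; apply: ltW; [exact: Kx|exact: Kt].
pose zb : point := (x0 - ebase R ord_max, t1 + T).
have sqb : sqn (zb.1 - x0) = 1.
  rewrite /= addrAC subrr add0r -[- _]add0r -scaleN1r sqn_line sqn0 mxE; ring.
have Kb : K zb by split; rewrite /= ?sqb//; apply/andP; split; lra.
have [z Kz minz] := comparison_min us (@compact_cylinder R n x0 1 (t1 + dl) (t1 + T))
  (ex_intro _ _ Kb) KQ (@barrier_continuous R n p M T t1 dl x0 hp T0 dl0).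
have [z1 /andP[zt zT]] := Kz.
have wb : w zb = M - q * (1 + kap) - Cb - Ct * T.
  rewrite (wF zb) ?sqb// /F /spike_barrier /cap_barrier subrr powR0; last by rewrite gt_eqF//; lra.
  rewrite /= (_ : t1 + T - t1 = T); last by ring.
  by rewrite divff ?gt_eqF// powR1 -/q; ring.
have zneg : unc u z - w z < 0.
  apply: le_lt_trans (minz _ Kb) _; rewrite -/(w zb) wb /unc /=.
  have : Ct * T <= Ct by rewrite ler_piMr// ltW.
  move: WM; rewrite /W; lra.
have r0 := sqn_ge0 (z.1 - x0).
have tz : t1 < z.2 by lra.
have cge : 0 <= cap t1 (sqn (z.1 - x0)) z.2.
  by apply: cap_ge0 => //; [exact: ltW | rewrite r0].
have sge := spike_ge n hp T0 tz r0.
(* On the initial face [u > M >= w] within distance [k] of the centre; farther out the spike gives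
   [w < 0 <= u], by nonnegativity of [u]. *)
have z2 : t1 + dl < z.2.
  rewrite lt_neqAle zt andbT; apply/negP => /eqP zE.
  have zE' : z.2 - t1 = dl by lra.
  have [kz|kz] := ltP (sqn (z.1 - x0)) (k ^+ 2).
    have := Hk z.1 z.2 kz; rewrite zE' (gtr0_norm dl0) => /(_ dlk).
    move: zneg; rewrite wF// /F /unc.
    have : 0 <= spike T t1 (sqn (z.1 - x0)) z.2.
      by apply: le_trans sge; rewrite !mulr_ge0 ?powR_ge0.
    lra.
  have un : 0 <= unc u z by apply: (@ancient_nonneg R n p u) => //; [lra|exact: Kx|exact: Kt].
  suff : `|M| + 1 <= spike T t1 (sqn (z.1 - x0)) z.2.
    have := ler_norm M; move: zneg; rewrite wF// /F; lra.
  apply: le_trans sge; rewrite zE' -/q -/m powRN.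
  have P0 : 0 < (dl / T) `^ m by rewrite powR_gt0// divr_gt0.
  rewrite mulrCA ler_pdivlMl//; apply: (@le_trans _ _ (q * k ^+ 2)); last by rewrite ler_pM2l.
  by rewrite -ler_pdivlMr.
have z11 : sqn (z.1 - x0) < 1.
  rewrite lt_neqAle z1 andbT; apply/negP => /eqP s1.
  apply: (@no_min_on_sphere R n p u x0 z (fun r => F r z.2)) => //; [exact: Kx|exact: Kt| |].
    move=> r /andP[rr0 rr1]; rewrite /F /cap_barrier /spike_barrier subrr powR0; last by rewrite gt_eqF//; lra.
    set S := (_ / T) `^ _.
    have : q * (S * r) <= q * S.
      by rewrite ler_pM2l// ler_piMr// powR_ge0.
    by rewrite -/q; lra.
  move=> x xr; have Kxz : K (x, z.2) by split => //=; rewrite zt.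
  by have := minz _ Kxz; rewrite -/(w z) -/(w (x, z.2)) (wF (x, z.2))// wF// s1.
have [D1 D2 Dt] := barrier_derivs n M hp T0 tz z11.
have Hmin : \forall z' \near (z.1, z.2), z'.2 <= z.2 ->
     u z.1 z.2 - F (sqn (z.1 - x0)) z.2 <= u z'.1 z'.2 - F (sqn (z'.1 - x0)) z'.2.
  have c2 : (fun z : point => z.2) @ (z.1, z.2) --> z.2 by exact: cvg_snd.
  near=> z' => z't.
  have Hs : sqn (z'.1 - x0) <= 1.
    by apply: ltW; near: z'; exact: (cvgr_lt _ (@sqn1_continuous R n x0 (z.1, z.2)) _ z11).
  have Kz' : K z'.
    split => //; apply/andP; split; last by exact: le_trans zT.
    by apply: ltW; near: z'; exact: (cvgr_gt _ c2 _ z2).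
  by have := minz _ Kz'; rewrite -/(w z) -/(w z') wF// wF.
have := radial_comparison us (Kx _ Kz) (Kt _ Kz) D1 D2 Dt Hmin.
apply/negP; rewrite -ltNge; set r := sqn (z.1 - x0) in z11 r0 *.
set a := T `^ _ * _; set D := (1 - r) `^ (- be).
have s0 : 0 < (z.2 - t1) / T by rewrite divr_gt0// subr_gt0.
have a0 : 0 < a by rewrite mulr_gt0 ?powR_gt0.
have N0 : 0 < 2 * d + 4 by rewrite addr_gt0 ?mulr_gt0.
have D0 : 0 < D by rewrite powR_gt0// subr_gt0.
have T01 : 0 < T <= 1 by rewrite T0.
have z01 : 0 <= r < 1 by rewrite r0.
have S1 := spike_num n hp T01 s0 r0 (erefl a).
have S2 := cap_num hp z01 (erefl (2 * d + 4)) (erefl D).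
rewrite normrN gtr0_norm; last by apply: addr_gt0 => //; exact: mulr_gt0.
(* Spike and cap have radial gradients of the same sign, so their lengths add and superadditivity
   separates the two barriers. *)
have S3 : (2 * Num.sqrt r * a) `^ p + (2 * Num.sqrt r * ((2 * d + 4) * D)) `^ p <=
    (2 * Num.sqrt r * (a + (2 * d + 4) * D)) `^ p.
  rewrite [in leRHS]mulrDr.
  have S0 : 0 <= 2 * Num.sqrt r by rewrite mulr_ge0// sqrtr_ge0.
  apply: powR_superadd; [exact: p1 | exact: mulr_ge0 S0 (ltW a0) |].
  exact: mulr_ge0 S0 (ltW (mulr_gt0 N0 D0)).
exact: lt_le_trans (barrier_sum S1 S2) S3.
Unshelve. all: by end_near.
Qed.

Definition bound_const := 1 + kap + Cb + Ct.

(** At height 1 the unit ball touches the boundary, so [boundary_descent] is applied at height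
    [1 + s]. As [s] tends to 0 the lower point reaches the boundary, where [u = 0], and continuity
    of [u] up to the boundary gives the bound. *)
Lemma bound_height1 u (x0 : 'rV[R]_n.+1) (t1 T : R) : 2 < p -> ancient_solution p u ->
  xlast x0 = 1 -> 0 < T <= 1 -> t1 + T < 0 -> u x0 t1 <= bound_const * (1 + T `^ (- be)).
Proof.
move=> hp us x01 T01 t1T; have [/andP[b0 b1] bp] := conj_exp hp.
have [k0 c0 ct0] := barrier_consts n hp.
have q0 := powR_ge0 T (- be).
apply: (@le_trans _ _ (T `^ (- be) * (1 + kap) + Cb + Ct)); last first.
  rewrite /bound_const.
  have -> : (1 + kap + Cb + Ct) * (1 + T `^ (- be)) = T `^ (- be) * (1 + kap) + Cb + Ct +
     (1 + kap + T `^ (- be) * (Cb + Ct)) by ring.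
  by rewrite lerDl addr_ge0 ?mulr_ge0//; lra.
set W := _ + Ct; move: (T01) => /andP[T0 T1].
have t10 : t1 < 0 by lra.
pose xs (s : R) := x0 + s *: ebase R ord_max.
have xls s : xlast (xs s) = 1 + s.
  by rewrite /xs -x01 /xlast !mxE !eqxx mulr1.
have [uC ucl _ ub] := us.
apply/ler_addgt0Pr => e e0.
have [|_ [cu _ _ _]] := uC (x0, t1); first by rewrite /Qset/= x01.
have xb : xlast (x0 - ebase R ord_max) = 0 by move: x01; rewrite /xlast !mxE !eqxx/= => ->; rewrite subrr.
have Qb : @Qclos R n (x0 - ebase R ord_max, t1 + T) by split; rewrite /= ?xb; lra.
have cb := (subspace_continuousP _ _).1 ucl _ Qb.
have e20 : 0 < e / 2 by lra.
have ub0 := ub _ _ xb t1T.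
have eb : unc u (x0 - ebase R ord_max, t1 + T) < e / 2 by rewrite /unc/= ub0.
have : \forall z \near (x0 - ebase R ord_max, t1 + T), @Qclos R n z -> unc u z < e / 2.
  by exact: (@cvgr_lt _ _ _ (within_filter _ (nbhs_filter _)) _ _ cb _ eb).
move=> /near_lines[d1 d10 [H1 _]].
have ea : u x0 t1 - e / 2 < unc u (x0, t1) by rewrite /unc/=; lra.
have : \forall z \near (x0, t1), u x0 t1 - e / 2 < unc u z by exact: (cvgr_gt _ cu _ ea).
move=> /near_lines[d2 d20 [H2 _]].
pose s := Num.min d1 d2 / 2.
have m0 : 0 < Num.min d1 d2 by rewrite lt_min d10.
have s0 : 0 < s by rewrite divr_gt0.
have sd1 : `|s| < d1 by rewrite gtr0_norm// (@lt_le_trans _ _ (Num.min d1 d2))// ?ge_min ?lexx// /s; lra.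
have sd2 : `|s| < d2 by rewrite gtr0_norm// (@lt_le_trans _ _ (Num.min d1 d2))// ?ge_min ?lexx ?orbT// /s; lra.
have A := H2 ord_max s sd2; rewrite /unc/= in A.
have E : xs s - ebase R ord_max = x0 - ebase R ord_max + s *: ebase R ord_max by rewrite /xs addrAC.
have Qs : @Qclos R n (x0 - ebase R ord_max + s *: ebase R ord_max, t1 + T).
  split => /=; last lra.
  by move: (xls s); rewrite -E /xlast !mxE !eqxx/= => ->; lra.
have B := H1 ord_max s sd1 Qs; rewrite /unc/= in B.
have x1s : 1 < xlast (xs s) by rewrite xls; lra.
have := boundary_descent hp us x1s T01 t1T; rewrite E -/W.
have -> : xs s = x0 + s *: ebase R ord_max by [].
rewrite -/W; lra.
Qed.

End UpperBound.

(** * Scaling *)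

Section Scaling.
Variables (R : realType) (n : nat) (p l c : R).
Notation point := ('rV[R]_n.+1 * R)%type.
Implicit Types (u : 'rV[R]_n.+1 -> R -> R) (x : 'rV[R]_n.+1) (i : 'I_n.+1).

Lemma line_is_derive (f : 'rV[R]_n.+1 -> R) x i a :
  is_derive (0 : R) 1 (fun r => f (x + r *: ebase R i)) a -> is_derive x (ebase R i) f a.
Proof.
set e := ebase R i => -[H1 H2].
have E : (fun h : R => h^-1 *: (f (x + (h *: 1 + 0) *: e) - f (x + 0 *: e))) =
   (fun h : R => h^-1 *: (f (h *: e + x) - f x)).
  apply/funext => h; congr (_ *: (f _ - f _)); last by rewrite scale0r addr0.
  by rewrite /(h *: 1)/= mulr1 addr0 addrC.
by split; [move: H1 | rewrite -H2]; rewrite /derivable /derive/= E.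
Qed.

Definition rescale u : 'rV[R]_n.+1 -> R -> R := fun x t => c * u (l *: x) (l ^+ 2 * t).
Definition dil (z : point) : point := (l *: z.1, l ^+ 2 * z.2).

Hypothesis l0 : 0 < l.

Lemma xlast_scale x : xlast (l *: x) = l * xlast x.
Proof. by rewrite /xlast mxE. Qed.

Lemma Qset_dil (z : point) : Qset z -> Qset (dil z).
Proof.
move=> [z1 z2]; split; rewrite /= ?xlast_scale ?mulr_gt0//.
by rewrite pmulr_rlt0// exprn_gt0.
Qed.

Lemma Qclos_dil (z : point) : Qclos z -> Qclos (dil z).
Proof.
move=> [z1 z2]; split; rewrite /= ?xlast_scale ?mulr_ge0 ?(ltW l0)//.
by rewrite mulr_ge0_le0// exprn_ge0// ltW.
Qed.

Lemma Qset_near (z : point) : Qset z -> \forall z' \near z, Qset z'.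
Proof.
move=> [z1 z2].
have c2 : (fun z : point => z.2) @ z --> z.2 by exact: cvg_snd.
near=> z'; split.
  by near: z'; exact: (cvgr_gt _ (@xlast1_continuous R n z) _ z1).
by near: z'; exact: (cvgr_lt _ c2 _ z2).
Unshelve. all: by end_near.
Qed.

Lemma dil_continuous : continuous dil.
Proof.
move=> z.
have H1 : (fun w : point => l *: w.1) @ z --> (l *: z.1 : 'rV[R]_n.+1).
  have H := @cvgZl_tmp R 'rV[R]_n.+1 _ (nbhs z) (nbhs_filter z) l fst z.1.
  by apply: H; exact: cvg_fst.
have H2 : (fun w : point => l ^+ 2 * w.2) @ z --> l ^+ 2 * z.2.
  by apply: cvgM; [exact: cvg_cst | exact: cvg_snd].
exact: (@cvg_pair _ _ _ _ _ _ (nbhs_filter _) (nbhs_filter _) (nbhs_filter _) _ _ H1 H2).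
Qed.

Lemma is_derive_rescale (f : 'rV[R]_n.+1 -> R) (k : R) x i :
  derivable f (l *: x) (ebase R i) ->
  is_derive x (ebase R i) (fun y => k * f (l *: y)) (k * l * 'D_(ebase R i) f (l *: x)).
Proof.
move=> df; apply: line_is_derive.
have E : (fun r : R => k * f (l *: (x + r *: ebase R i))) =
    (fun r => k * (fun s => f (l *: x + s *: ebase R i)) (l * r)).
  by apply/funext => r; rewrite scalerDr scalerA.
have D : is_derive (l * 0) 1 (fun s => f (l *: x + s *: ebase R i)) ('D_(ebase R i) f (l *: x)).
  rewrite mulr0; have := @is_derive_line R n f (l *: x) i 0.
  by rewrite scale0r addr0; apply.
have Dl : is_derive (0 : R) 1 (fun r => l * r) l by derive_rules; ring.
have D3 : is_derive (0 : R) 1 (fun r => f (l *: x + (l * r) *: ebase R i))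
    ('D_(ebase R i) f (l *: x) * l) by exact: (@is_derive_chain R _ ( *%R l) 0 _ _ D Dl).
by rewrite E; derive_rules; ring.
Qed.

Lemma pdx_rescale u x t i : C21_Q u -> Qset (x, t) ->
  pdx i (rescale u) x t = c * l * pdx i u (l *: x) (l ^+ 2 * t).
Proof.
move=> uC /Qset_dil Qz; have [[H _ _] _] := uC _ Qz.
by have [_ H2] := is_derive_rescale c (H i); rewrite -H2.
Qed.

Lemma near_line_Q x t i : Qset (x, t) -> \forall r \near (0 : R), Qset (x + r *: ebase R i, t).
Proof.
move=> /Qset_near/near_lines[d d0 [H _]]; near=> r; apply: H; near: r.
by apply/nbhs_ballP; exists d => // r; rewrite /ball/= sub0r normrN.
Unshelve. all: by end_near.
Qed.

Lemma is_derive_pdx_rescale u x t i j : C21_Q u -> Qset (x, t) ->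
  is_derive x (ebase R i) (fun y => pdx j (rescale u) y t)
    (c * l ^+ 2 * pdx i (pdx j u) (l *: x) (l ^+ 2 * t)).
Proof.
move=> uC Qz; have [[_ H _] _] := uC _ (Qset_dil Qz).
have [DD DV] := is_derive_rescale (c * l) (H i j).
have D0 := @is_derive_line R n (fun y => c * l * pdx j u (l *: y) (l ^+ 2 * t)) x i 0.
apply: line_is_derive.
(* The formula for the first derivatives is known only in [Q], so it is differentiated through
   equality near the point. *)
have H0 : \forall r \near (0 : R), c * l * pdx j u (l *: (x + r *: ebase R i)) (l ^+ 2 * t) =
    pdx j (rescale u) (x + r *: ebase R i) t.
  by near=> r; rewrite pdx_rescale//; near: r; exact: near_line_Q.
apply: (near_eq_is_derive H0).
  move: D0; rewrite scale0r addr0 => /(_ DD) D0.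
  apply: (is_derive_eq D0); rewrite DV /pdx/=; ring.
Unshelve. all: by end_near.
Qed.

Lemma pdx2_rescale u x t i j : C21_Q u -> Qset (x, t) ->
  pdx i (pdx j (rescale u)) x t = c * l ^+ 2 * pdx i (pdx j u) (l *: x) (l ^+ 2 * t).
Proof. by move=> uC Qz; have [_ <-] := is_derive_pdx_rescale i j uC Qz. Qed.

Lemma is_derive_time_rescale u x t : C21_Q u -> Qset (x, t) ->
  is_derive t 1 (rescale u x) (c * l ^+ 2 * pdt u (l *: x) (l ^+ 2 * t)).
Proof.
move=> uC /Qset_dil Qz; have [[_ _ H] _] := uC _ Qz.
have D := derivableP H.
have Dl : is_derive t 1 (fun r => l ^+ 2 * r) (l ^+ 2) by derive_rules; ring.
have D3 : is_derive t 1 (fun r => u (l *: x) (l ^+ 2 * r))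
    (pdt u (l *: x) (l ^+ 2 * t) * l ^+ 2) by exact: (@is_derive_chain R _ ( *%R (l ^+ 2)) t _ _ D Dl).
by rewrite /rescale; derive_rules; ring.
Qed.

Lemma pdt_rescale u x t : C21_Q u -> Qset (x, t) ->
  pdt (rescale u) x t = c * l ^+ 2 * pdt u (l *: x) (l ^+ 2 * t).
Proof. by move=> uC Qz; have [_ <-] := is_derive_time_rescale uC Qz. Qed.

Lemma continuous_rescale (f g : point -> R) (k : R) (z : point) : Qset z ->
  (forall z', Qset z' -> g z' = k * f (dil z')) -> {for dil z, continuous f} ->
  {for z, continuous g}.
Proof.
move=> Qz gf cf; rewrite /prop_for /continuous_at gf//.
have H : (fun z' => k * f (dil z')) @ z --> k * f (dil z).
  apply: cvgM; first exact: cvg_cst.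
  by apply: (@continuous_cvg _ _ _ _ _ dil f); [exact: cf | exact: dil_continuous].
apply: cvg_trans H; apply: near_eq_cvg.
by near=> z'; rewrite gf//; near: z'; exact: Qset_near.
Unshelve. all: by end_near.
Qed.

Lemma gradnorm_rescale u x t : 0 < c -> C21_Q u -> Qset (x, t) ->
  gradnorm (rescale u) x t = c * l * gradnorm u (l *: x) (l ^+ 2 * t).
Proof.
move=> c0 uC Qz; rewrite /gradnorm.
under eq_bigr do rewrite pdx_rescale// exprMn.
rewrite -mulr_sumr sqrtrM ?sqr_ge0// sqrtr_sqr ger0_norm//.
by rewrite mulr_ge0// ltW.
Qed.

(** The two sides of the equation are multiplied by [c l ^ 2] and [(c l) ^ p]; these agree for this
    [c] because [be p = 1 + be]. *)
Lemma rescale_ancient u : 2 < p -> c = l `^ ((p - 1)^-1 - 1) ->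
  ancient_solution p u -> ancient_solution p (rescale u).
Proof.
move=> hp cE [uC ucl ueq ub].
have c0 : 0 < c by rewrite cE powR_gt0.
split.
- move=> [x t] Qz; have [[H1 H2 H3] [C1 C2 C3 C4]] := uC _ (Qset_dil Qz).
  split; split.
  + by move=> i; apply: ex_derive; exact: (is_derive_rescale c (H1 i)).
  + by move=> i j; exact: (@ex_derive _ _ _ _ _ _ _ (is_derive_pdx_rescale i j uC Qz)).
  + exact: (@ex_derive _ _ _ _ _ _ _ (is_derive_time_rescale uC Qz)).
  + exact: (@continuous_rescale (unc u) (unc (rescale u)) c (x, t) Qz (fun _ _ => erefl) C1).
  + move=> i; apply: (@continuous_rescale (unc (pdx i u)) (unc (pdx i (rescale u)))
      (c * l) (x, t) Qz _ (C2 i)) => -[y s] Qy.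
    exact: (pdx_rescale i uC Qy).
  + move=> i j; apply: (@continuous_rescale (unc (pdx i (pdx j u)))
      (unc (pdx i (pdx j (rescale u)))) (c * l ^+ 2) (x, t) Qz _ (C3 i j)) => -[y s] Qy.
    exact: (pdx2_rescale i j uC Qy).
  + apply: (@continuous_rescale (unc (pdt u)) (unc (pdt (rescale u)))
      (c * l ^+ 2) (x, t) Qz _ C4) => -[y s] Qy.
    exact: (pdt_rescale uC Qy).
- apply/subspace_continuousP => z Qz.
  have H := (subspace_continuousP _ _).1 ucl _ (Qclos_dil Qz).
  apply: cvgM; first exact: cvg_cst.
  apply: (cvg_comp dil (unc u) _ H) => P HP.
  have HP1 : \forall y \near dil z, Qclos y -> P y by exact: HP.
  have HP2 : \forall z' \near z, Qclos (dil z') -> P (dil z') by exact: (dil_continuous HP1).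
  change (\forall z' \near z, Qclos z' -> P (dil z')).
  by apply: filterS HP2 => z' HP' Qz'; apply: HP'; exact: Qclos_dil.
- move=> x t x0 t0; have Qz : Qset (x, t) by [].
  have [y0 s0] := Qset_dil Qz; rewrite /= in y0 s0.
  rewrite gradnorm_rescale// pdt_rescale// /lap.
  under eq_bigr do rewrite pdx2_rescale//.
  rewrite -mulr_sumr -mulrBr -/(lap _ _ _) ueq//.
  rewrite powRM ?sqrtr_ge0//; last by rewrite mulr_ge0// ltW.
  congr (_ * _); rewrite cE.
  have -> : l `^ ((p - 1)^-1 - 1) * l = l `^ (p - 1)^-1.
    rewrite -{2}(powRr1 (ltW l0)) -powRD ?subrK//.
    by rewrite (gt_eqF l0) implybT.
  rewrite -powR_mulrn ?(ltW l0)// -powRD; last by rewrite (gt_eqF l0) implybT.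
  rewrite -powRrM; congr (_ `^ _).
  by have [_ ->] := conj_exp hp; lra.
- move=> x t x0 t0; rewrite /rescale ub ?mulr0//; first by rewrite xlast_scale x0 mulr0.
  by rewrite pmulr_rlt0// exprn_gt0.
Qed.

End Scaling.

(** * Gradient bound *)

Section DoublingAlgebra.
Variable R : realType.

Lemma one_add_powR_le (z p : R) : 0 <= z -> 0 <= p -> (1 + z) `^ p <= expR (p * z).
Proof.
move=> z0 p0; rewrite -[expR _](_ : (expR z) `^ p = _); last by rewrite /powR gt_eqF ?expR_gt0// expRK.
by apply: powR_le => //; [lra | exact: expR_ge1Dx].
Qed.

Lemma expR_gap (x y : R) : 0 <= x -> 2 * x <= y -> expR x - expR y <= - (y / 2).
Proof.
move=> x0 xy; have e1 : 1 <= expR x by apply: le_trans (expR_ge1Dx x); lra.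
have -> : expR y = expR x * expR (y - x) by rewrite -expRD subrKC.
have := expR_ge1Dx (y - x); nra.
Qed.

(** [P ^ p] exceeds [g ^ p] by a factor of at most [e ^ (p zeta)], while [b] exceeds [a] by at least
    [e ^ B] with [B] at least twice [p zeta]. [expR_gap] measures the surplus, and
    [g ^ 2 <= g ^ p]. *)
Lemma power_gap (p g zeta B a b P : R) : 2 <= p -> 1 <= g -> 0 <= zeta ->
  2 * (p * zeta) <= B -> 1 <= a -> a * expR B <= b -> 0 <= P <= g * (1 + zeta) ->
  a * P `^ p - b * g `^ p <= - (g ^+ 2 * (B / 2)).
Proof.
move=> p2 g1 z0 zB a1 ab /andP[P0 Pg].
have G0 : 0 <= g `^ p by exact: powR_ge0.
have Gg : g ^+ 2 <= g `^ p.
  by rewrite -powR_mulrn; [apply: ler_powR | lra].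
have H1 : P `^ p <= g `^ p * expR (p * zeta).
  apply: (@le_trans _ _ ((g * (1 + zeta)) `^ p)); first by apply: powR_le => //; lra.
  rewrite powRM; [|lra|lra]; apply: ler_wpM2l => //; apply: one_add_powR_le; lra.
have H2 : a * P `^ p <= a * (g `^ p * expR (p * zeta)) by apply: ler_wpM2l => //; lra.
have H3 : a * expR B * g `^ p <= b * g `^ p by apply: ler_wpM2r.
have pz : 0 <= p * zeta by apply: mulr_ge0; lra.
have H4 := expR_gap pz zB.
have B0 : 0 <= B / 2 by lra.
have H5 : a * g `^ p * (B / 2) >= g ^+ 2 * (B / 2).
  apply: ler_wpM2r => //; rewrite -[leLHS]mul1r; apply: ler_pM => //; exact: sqr_ge0.
have H6 : a * g `^ p * (expR (p * zeta) - expR B) <= a * g `^ p * - (B / 2).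
  by apply: ler_wpM2l => //; apply: mulr_ge0 => //; lra.
lra.
Qed.

(* The constant [20 + 4 d] is what makes the cubic gain beat the localisation errors. *)
Lemma doubling_absurd (p L eta de a b P G d : R) : 2 <= p -> 1 <= d -> L = 20 + 4 * d ->
  1 <= eta -> 0 < de -> 1 <= a -> a * expR ((p - 1) * (L * eta * de)) <= b ->
  0 <= P -> P <= L * eta + L * de * (2 * eta ^+ 2) ->
  (L * eta) ^+ 2 - P ^+ 2 <= 2 * (L * eta) * (L * de * (2 * eta ^+ 2)) ->
  - ((2 * d + 9) * eta ^+ 3) <= G ->
  (L * eta) ^+ 2 - b * (L * eta) `^ p - P ^+ 2 + a * P `^ p < L * de * G.
Proof.
move=> p2 d1 LE e1 de0 a1 ab P0 Pg Pq Gge.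
have L24 : 24 <= L by lra.
have L0 : 0 < L by lra.
have Le1 : 1 <= L * eta by nra.
have ed0 : 0 < eta * de by apply: mulr_gt0; lra.
have zB : 2 * (p * (2 * (eta * de))) <= (p - 1) * (L * eta * de).
  have -> : (p - 1) * (L * eta * de) = (p - 1) * L * (eta * de) by ring.
  have -> : 2 * (p * (2 * (eta * de))) = 4 * p * (eta * de) by ring.
  rewrite ler_pM2r//; nra.
have PP : 0 <= P <= L * eta * (1 + 2 * (eta * de)).
  by rewrite P0/=; apply: le_trans Pg _; rewrite (_ : L * eta * (1 + _) = L * eta + L * de * (2 * eta ^+ 2)) //; ring.
have z0 : 0 <= 2 * (eta * de) by lra.
have := power_gap p2 Le1 z0 zB a1 ab PP.
have -> : (L * eta) ^+ 2 * ((p - 1) * (L * eta * de) / 2) = (p - 1) * (L ^+ 3 * (eta ^+ 3 * de) / 2) by ring.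
set W := eta ^+ 3 * de; have W0 : 0 < W by rewrite mulr_gt0// exprn_gt0//; lra.
move=> H1.
have H2 : L ^+ 3 * W / 2 <= (p - 1) * (L ^+ 3 * W / 2).
  by rewrite ler_peMl//; [rewrite divr_ge0// mulr_ge0// ?exprn_ge0// ltW | lra].
have H3 : - (L * ((2 * d + 9) * W)) <= L * de * G.
  rewrite -mulrA -mulrN ler_pM2l// /W.
  have -> : - ((2 * d + 9) * (eta ^+ 3 * de)) = de * - ((2 * d + 9) * eta ^+ 3) by ring.
  by rewrite ler_pM2l.
have H4 : 2 * (L * eta) * (L * de * (2 * eta ^+ 2)) = 4 * L ^+ 2 * W by rewrite /W; ring.
(* After division by [L W] this reads [4 L + 2 d + 9 < L ^ 2 / 2]: the errors are linear in [L], the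
   gain is quadratic. *)
have H5 : 4 * L ^+ 2 * W + L * ((2 * d + 9) * W) < L ^+ 3 * W / 2.
  have -> : 4 * L ^+ 2 * W + L * ((2 * d + 9) * W) = (4 * L + (2 * d + 9)) * (L * W) by ring.
  have -> : L ^+ 3 * W / 2 = L ^+ 2 / 2 * (L * W) by ring.
  rewrite ltr_pM2r; last by rewrite mulr_gt0.
  rewrite LE; nra.
lra.
Qed.

(** Cauchy-Schwarz, from the nonnegative sum of [(k e i - s f i) ^ 2] with [s = 1] and [s = -1]. *)
Lemma sum_unit_le (n : nat) (e f : 'I_n -> R) (k : R) : 0 < k ->
  \sum_i e i ^+ 2 = 1 -> \sum_i f i ^+ 2 <= k ^+ 2 -> `|\sum_i e i * f i| <= k.
Proof.
move=> k0 e1 fk.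
have H (s : R) : s ^+ 2 = 1 -> 2 * k * (s * \sum_i e i * f i) <= 2 * k ^+ 2.
  move=> s1; have : 0 <= \sum_i (k * e i - s * f i) ^+ 2 by apply: sumr_ge0 => i _; exact: sqr_ge0.
  have -> : \sum_i (k * e i - s * f i) ^+ 2 = k ^+ 2 * (\sum_i e i ^+ 2) - 2 * k * (s * \sum_i e i * f i) + s ^+ 2 * \sum_i f i ^+ 2.
    rewrite !mulr_sumr -sumrB -big_split/=; apply: eq_bigr => i _; ring.
  rewrite e1 s1; lra.
have H1 := H 1 (expr1n _ _); have H2 := H (-1) ltac:(by rewrite sqrrN expr1n).
rewrite ler_norml; apply/andP; split; nra.
Qed.

End DoublingAlgebra.

(** * The logarithmic transform *)

Section LogSolution.
Variables (R : realType) (n : nat).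
Implicit Types (u : 'rV[R]_n.+1 -> R -> R) (x : 'rV[R]_n.+1) (i : 'I_n.+1).

(** For [0 <= u <= N] the argument lies between [N] and [2 N], so the logarithm oscillates by at
    most [ln 2]. [lw1], [lw2] and [lwt] are its first and second derivatives along a coordinate and
    its time derivative. *)
Definition lw (N : R) u x t := ln (2 * N - u x t).
Definition lw1 (N : R) u i x t := - pdx i u x t / (2 * N - u x t).
Definition lw2 (N : R) u i x t :=
  - pdx i (pdx i u) x t / (2 * N - u x t) - lw1 N u i x t ^+ 2.
Definition lwt (N : R) u x t := - pdt u x t / (2 * N - u x t).

Lemma lw_line N u x i t s : C21_Q u -> t < 0 -> `|s| < xlast x ->
  0 < 2 * N - u (x + s *: ebase R i) t ->
  is_derive s 1 (fun r => lw N u (x + r *: ebase R i) t) (lw1 N u i (x + s *: ebase R i) t).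
Proof.
move=> uC t0 sx w0; have D := C21_line i uC t0 sx.
by rewrite /lw /lw1; derive_rules; congr (_ / _); ring.
Qed.

Lemma lw_line2 N u x i t : C21_Q u -> t < 0 -> 0 < xlast x -> 0 < 2 * N - u x t ->
  is_derive (0 : R) 1 (fun r => lw1 N u i (x + r *: ebase R i) t) (lw2 N u i x t).
Proof.
move=> uC t0 x0 w0; have nx0 : `|0 : R| < xlast x by rewrite normr0.
have D := C21_line i uC t0 nx0; have D2 := C21_line2 i uC t0 x0.
have w1 : 2 * N - u (x + 0 *: ebase R i) t != 0 by rewrite scale0r addr0 gt_eqF.
rewrite /lw1; derive_rules; rewrite /lw2 /lw1 !scale0r !addr0.
by field; rewrite gt_eqF.
Qed.

Lemma lw_time N u x t : C21_Q u -> t < 0 -> 0 < xlast x -> 0 < 2 * N - u x t ->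
  is_derive t 1 (lw N u x) (lwt N u x t).
Proof.
move=> uC t0 x0 w0; have D := C21_time uC t0 x0.
by rewrite /lw /lwt; derive_rules; congr (_ / _); ring.
Qed.

(** With [w = 2 N - u] the gradient of [lw] has length [|grad u| / w], so the source
    [|grad u| ^ p / w] equals [w ^ (p - 1) |grad lw| ^ p]. The explicit factor [w ^ (p - 1)] is what
    doubling of variables exploits. *)
Lemma lw_pde p N u x t : 2 <= p -> ancient_solution p u -> t < 0 -> 0 < xlast x ->
  0 < 2 * N - u x t ->
  lwt N u x t - \sum_i lw2 N u i x t =
  \sum_i lw1 N u i x t ^+ 2 -
  (2 * N - u x t) `^ (p - 1) * Num.sqrt (\sum_i lw1 N u i x t ^+ 2) `^ p.
Proof.
move=> hp [_ _ ueq _] t0 x0; set w := 2 * N - u x t => w0.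
have -> : \sum_i lw2 N u i x t = - lap u x t / w - \sum_i lw1 N u i x t ^+ 2.
  by rewrite /lw2 big_split/= sumrN; congr (_ + _); rewrite /lap mulNr mulr_suml -sumrN; apply: eq_bigr => i _; rewrite mulNr.
have -> : Num.sqrt (\sum_i lw1 N u i x t ^+ 2) = gradnorm u x t / w.
  rewrite /lw1 (eq_bigr (fun i => (w^-1) ^+ 2 * (pdx i u x t) ^+ 2)); last first.
    by move=> i _; rewrite -/w; field; rewrite gt_eqF.
  rewrite -mulr_sumr sqrtrM ?sqr_ge0// sqrtr_sqr ger0_norm ?invr_ge0 ?(ltW w0)//.
  by rewrite mulrC.
rewrite powRM ?sqrtr_ge0 ?invr_ge0 ?(ltW w0)// -ueq//.
have -> : w `^ (p - 1) * ((pdt u x t - lap u x t) * w^-1 `^ p) = (pdt u x t - lap u x t) / w.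
  rewrite mulrCA; congr (_ * _).
  have -> : w^-1 = w `^ (-1) by rewrite powR_inv1// ltW.
  by rewrite -powRrM -powRD ?(gt_eqF w0) ?implybT//; congr (_ `^ _); ring.
by rewrite /lwt -/w; ring.
Qed.

End LogSolution.

(** * Doubling of variables *)

Section Doubling.
Variables (R : realType) (n : nat).
Implicit Types (u : 'rV[R]_n.+1 -> R -> R) (x y v : 'rV[R]_n.+1) (i : 'I_n.+1).
Notation d := (n.+1%:R : R).

Definition nrm v := Num.sqrt (sqn v).

Lemma nrm_line v i : v != 0 ->
  is_derive (0 : R) 1 (fun r => nrm (v + r *: ebase R i)) (v 0 i / nrm v).
Proof.
move=> v0; have q0 : 0 < sqn v by rewrite lt_neqAle eq_sym sqn_eq0 v0 sqn_ge0.
have D : is_derive (0 : R) 1 (fun r => sqn (v + r *: ebase R i)) (2 * v 0 i).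
  rewrite (_ : (fun r => _) = (fun r => sqn v + 2 * r * v 0 i + r ^+ 2)); last first.
    by apply/funext => r; rewrite sqn_line.
  by derive_rules; ring.
have -> : (fun r => nrm (v + r *: ebase R i)) = (fun r => sqn (v + r *: ebase R i) `^ 2^-1).
  by apply/funext => r; rewrite powR12_sqrt// sqn_ge0.
have q1 : 0 < sqn (v + 0 *: ebase R i) by rewrite scale0r addr0.
derive_rules; rewrite scale0r addr0.
have -> : 2^-1 - 1 = - 2^-1 :> R by lra.
rewrite powRN powR12_sqrt ?(ltW q0)// -/(nrm v).
by field; rewrite gt_eqF// sqrtr_gt0.
Qed.

Variables (x0 : 'rV[R]_n.+1) (t0 : R).

(* Localisation weight: infinite on the parabolic boundary of the unit cylinder. *)
Definition cutoff x (t : R) := (1 - sqn (x - x0))^-1 + (t - t0 + 1)^-1.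
Definition cutoff1 i x := ((1 - sqn (x - x0)) ^+ 2)^-1 * (2 * (x - x0) 0 i).
Definition cutoff2 i x := 2 * ((1 - sqn (x - x0)) ^+ 2)^-1 +
  4 * (x - x0) 0 i ^+ 2 * (2 * ((1 - sqn (x - x0)) ^+ 3)^-1).

Lemma cutoff_line x t i : sqn (x - x0) < 1 -> exists G : R -> R,
  [/\ exists2 e, 0 < e & forall s : R, `|s| < e ->
        is_derive s 1 (fun r => cutoff (x + r *: ebase R i) t) (G s),
      is_derive (0 : R) 1 G (cutoff2 i x) & G 0 = cutoff1 i x].
Proof.
move=> x1; pose F (r : R) := (1 - r)^-1 + (t - t0 + 1)^-1.
pose F1 (r : R) := ((1 - r) ^+ 2)^-1.
have d0 : 0 < 1 - sqn (x - x0) by lra.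
have D1 r : `|r - sqn (x - x0)| < 1 - sqn (x - x0) -> is_derive r 1 F (F1 r).
  rewrite ltr_norml => /andP[_ r1]; have r0 : 1 - r != 0 by rewrite gt_eqF//; lra.
  by rewrite /F /F1; derive_rules; field.
have D2 : is_derive (sqn (x - x0)) 1 F1 (2 * ((1 - sqn (x - x0)) ^+ 3)^-1).
  have r0 : (1 - sqn (x - x0)) ^+ 2 != 0 by rewrite expf_neq0// gt_eqF.
  by rewrite /F1; derive_rules; field; rewrite gt_eqF.
have [H1 H2] := radial_line i d0 D1 D2.
exists (fun s => F1 (sqn (x + s *: ebase R i - x0)) * (2 * (x - x0) 0 i + 2 * s)).
split; [exact: H1 | exact: H2 |].
by rewrite scale0r addr0 mulr0 addr0.
Qed.

Lemma cutoff_time x t : t0 - 1 < t -> is_derive t 1 (cutoff x) (- ((t - t0 + 1) ^+ 2)^-1).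
Proof.
move=> tt; have r0 : t - t0 + 1 != 0 by rewrite gt_eqF//; lra.
by rewrite /cutoff; derive_rules; field.
Qed.

(** With [A] and [B] the two summands of the cutoff, the squared gradient is [4 r A ^ 4], the
    Laplacian [2 d A ^ 2 + 8 r A ^ 3] and the time derivative [- B ^ 2]. As [A, B >= 1], powers of
    [A + B] dominate all of them, with [2 d + 8 + 1] in the last bound. *)
Lemma cutoff_bounds x t : sqn (x - x0) < 1 -> t0 - 1 < t <= t0 ->
  [/\ 1 <= cutoff x t, \sum_i cutoff1 i x ^+ 2 <= (2 * cutoff x t ^+ 2) ^+ 2 &
   - ((2 * d + 9) * cutoff x t ^+ 3) <= - ((t - t0 + 1) ^+ 2)^-1 - \sum_i cutoff2 i x].
Proof.
move=> x1 /andP[t1 t2]; rewrite /cutoff; set r := sqn (x - x0) in x1 *.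
have r0 : 0 <= r by exact: sqn_ge0.
set A := (1 - r)^-1; set B := (t - t0 + 1)^-1.
have A1 : 1 <= A by rewrite /A invf_ge1; lra.
have B1 : 1 <= B by rewrite /B invf_ge1; lra.
have AE : A <= A + B by lra.
have BE : B <= A + B by lra.
set E := A + B in AE BE *; have E1 : 1 <= E by lra.
have E0 : 0 <= E by lra.
have A2 : A ^+ 2 <= E ^+ 2 by rewrite lerXn2r ?nnegrE; lra.
have B2 : B ^+ 2 <= E ^+ 2 by rewrite lerXn2r ?nnegrE; lra.
have A3 : A ^+ 3 <= E ^+ 3 by rewrite lerXn2r ?nnegrE; lra.
have E23 : E ^+ 2 <= E ^+ 3 by rewrite [leRHS]exprS ler_peMl// sqr_ge0.
split => //.
  have -> : \sum_i cutoff1 i x ^+ 2 = (2 * A ^+ 2) ^+ 2 * r.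
    rewrite /r /sqn mulr_sumr; apply: eq_bigr => i _.
    by rewrite /cutoff1 -/r exprVn -/A; ring.
  apply: (@le_trans _ _ ((2 * A ^+ 2) ^+ 2)); first by rewrite ler_piMr ?sqr_ge0// ltW.
  have A20 := sqr_ge0 A; rewrite lerXn2r ?nnegrE; lra.
have -> : \sum_i cutoff2 i x = 2 * d * A ^+ 2 + 8 * r * A ^+ 3.
  rewrite big_split/= sumr_const card_ord -mulr_natr; congr (_ + _).
    by rewrite -/r exprVn -/A; ring.
  rewrite /r /sqn mulr_sumr mulr_suml; apply: eq_bigr => i _.
  by rewrite -/(sqn _) -/r exprVn -/A; ring.
rewrite -exprVn -/B.
have d0 : 0 <= d by [].
have H1 : 2 * d * A ^+ 2 <= 2 * d * E ^+ 3 by apply: ler_wpM2l; lra.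
have H2 : 8 * r * A ^+ 3 <= 8 * E ^+ 3.
  have A30 : 0 <= A ^+ 3 by apply: exprn_ge0; lra.
  have : r * A ^+ 3 <= A ^+ 3 by rewrite ler_piMl// ltW.
  lra.
lra.
Qed.

(** The cutoff involves [x] only; [ep > 0] keeps the penalty infinite on the parabolic boundary even
    where [x = y]. *)
Definition Psi (N L ep : R) u x y t :=
  lw N u y t - lw N u x t - L * cutoff x t * (nrm (x - y) + ep).

(** The derivative tests for [Psi] in [x], in [y], in both jointly and in time relate the
    derivatives of [lw] at the two points. Subtracting the equations there contradicts
    [doubling_absurd]. *)
Lemma doubling_no_max p N L ep dd u x y t : 2 <= p -> ancient_solution p u ->
  L = 20 + 4 * d -> 0 < ep -> 0 < dd -> t < 0 -> 0 < xlast x -> 0 < xlast y ->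
  1 <= 2 * N - u x t -> 0 < 2 * N - u y t -> sqn (x - x0) < 1 -> t0 - 1 < t <= t0 ->
  x != y -> 0 < Psi N L ep u x y t ->
  (forall i s, `|s| < dd ->
     [/\ 0 < 2 * N - u (x + s *: ebase R i) t, 0 < 2 * N - u (y + s *: ebase R i) t,
         Psi N L ep u (x + s *: ebase R i) y t <= Psi N L ep u x y t,
         Psi N L ep u x (y + s *: ebase R i) t <= Psi N L ep u x y t &
         Psi N L ep u (x + s *: ebase R i) (y + s *: ebase R i) t <= Psi N L ep u x y t]) ->
  (forall s, t - dd < s < t -> Psi N L ep u x y s <= Psi N L ep u x y t) -> False.
Proof.
move=> hp us LE ep0 dd0 tn xl yl wx1 wy0 x1 tt xy Psi0 maxx maxt.
have [uC _ _ _] := us.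
have wx0 : 0 < 2 * N - u x t by lra.
set E := cutoff x t; set v := x - y; have v0 : v != 0 by rewrite subr_eq0.
set de := nrm v + ep.
have q0 : 0 < sqn v by rewrite lt_neqAle eq_sym sqn_eq0 v0 sqn_ge0.
have nv0 : 0 < nrm v by rewrite /nrm sqrtr_gt0.
have de0 : 0 < de by rewrite addr_gt0.
have [E1 Eg Et] := cutoff_bounds x1 tt; rewrite -/E in E1 Eg Et.
have [t1 t2] := andP tt.
pose e i := v 0 i / nrm v.
have n0 : `|0 : R| < xlast x by rewrite normr0.
have n0y : `|0 : R| < xlast y by rewrite normr0.
have wx0' i : 0 < 2 * N - u (x + 0 *: ebase R i) t by rewrite scale0r addr0.
have wy0' i : 0 < 2 * N - u (y + 0 *: ebase R i) t by rewrite scale0r addr0.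
(* The cutoff does not depend on [y], so the gradient at [y] has length exactly [L E]; the one at
   [x] carries an extra cutoff term. *)
have Qi i : lw1 N u i y t = - (L * E * e i).
  have D1 := lw_line uC tn n0y (wy0' i).
  have D2 : is_derive (0 : R) 1 (fun r => nrm (x - (y + r *: ebase R i))) (- e i).
    have -> : (fun r => nrm (x - (y + r *: ebase R i))) = (fun r => nrm (v + (- r) *: ebase R i)).
      by apply/funext => r; rewrite opprD addrA scaleNr.
    have Dv : is_derive (- 0 : R) 1 (fun r => nrm (v + r *: ebase R i)) (e i).
      by rewrite oppr0; exact: nrm_line.
    have DN : is_derive (0 : R) 1 (fun r : R => - r) (-1) by derive_rules; ring.
    by apply: (is_derive_eq (@is_derive_chain R _ (fun r => - r) 0 _ _ Dv DN)); ring.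
  have D : is_derive (0 : R) 1 (fun r => - Psi N L ep u x (y + r *: ebase R i) t)
      (- (lw1 N u i y t - L * E * - e i)).
    rewrite scale0r addr0 in D1; rewrite /Psi -/E; derive_rules; ring.
  have := deriv_min D dd0; rewrite scale0r addr0 => H.
  have : - (lw1 N u i y t - L * E * - e i) = 0.
    by apply: H => s sd; rewrite lerN2; have [] := maxx i s sd.
  lra.
have Pi i : lw1 N u i x t = - (L * E * e i) - L * de * cutoff1 i x.
  have D1 := lw_line uC tn n0 (wx0' i).
  have D2 : is_derive (0 : R) 1 (fun r => nrm (x + r *: ebase R i - y)) (e i).
    have -> : (fun r => nrm (x + r *: ebase R i - y)) = (fun r => nrm (v + r *: ebase R i)).
      by apply/funext => r; rewrite addrAC.
    exact: nrm_line.
  have [G [[g g0 HG] _ G0]] := cutoff_line t i x1.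
  have D3 : is_derive (0 : R) 1 (fun r => cutoff (x + r *: ebase R i) t) (cutoff1 i x).
    by rewrite -G0; apply: HG; rewrite normr0.
  have D : is_derive (0 : R) 1 (fun r => - Psi N L ep u (x + r *: ebase R i) y t)
      (- (- lw1 N u i x t - L * (cutoff1 i x * de + E * e i))).
    rewrite scale0r addr0 in D1; rewrite /Psi; derive_rules.
    rewrite !scale0r !addr0 -/E -/v -/de; ring.
  have := deriv_min D dd0; rewrite scale0r addr0 => H.
  have : - (- lw1 N u i x t - L * (cutoff1 i x * de + E * e i)) = 0.
    by apply: H => s sd; rewrite lerN2; have [] := maxx i s sd.
  lra.
(* Moving [x] and [y] together leaves [x - y] fixed, so the distance contributes no second
   derivative. *)
have Di i : lw2 N u i y t - lw2 N u i x t <= L * de * cutoff2 i x.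
  have [G [[g g0 HG] HG2 G0]] := cutoff_line t i x1.
  have [m m0 [md [mx [my mg]]]] : exists2 m, 0 < m & m <= dd /\ m <= xlast x /\ m <= xlast y /\ m <= g.
    exists (Num.min (Num.min dd (xlast x)) (Num.min (xlast y) g)).
      by rewrite !lt_min dd0 xl yl g0.
    by rewrite !ge_min !lexx !orbT.
  have E2 (r : R) : Psi N L ep u (x + r *: ebase R i) (y + r *: ebase R i) t =
      lw N u (y + r *: ebase R i) t - lw N u (x + r *: ebase R i) t -
      L * cutoff (x + r *: ebase R i) t * de.
    by rewrite /Psi (_ : x + _ - _ = v)// opprD addrACA subrr addr0.
  have D1 (s : R) : `|s| < m -> is_derive s 1
     (fun r => - Psi N L ep u (x + r *: ebase R i) (y + r *: ebase R i) t)
     (- (lw1 N u i (y + s *: ebase R i) t - lw1 N u i (x + s *: ebase R i) t - L * de * G s)).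
    move=> sm; have sdd := lt_le_trans sm md.
    have [w1 w2 _ _ _] := maxx i s sdd.
    have D1 := lw_line uC tn (lt_le_trans sm mx) w1.
    have D2 := lw_line uC tn (lt_le_trans sm my) w2.
    have D3 := HG s (lt_le_trans sm mg).
    under eq_fun do rewrite E2.
    derive_rules; ring.
  have D2 : is_derive (0 : R) 1
     (fun s => - (lw1 N u i (y + s *: ebase R i) t - lw1 N u i (x + s *: ebase R i) t - L * de * G s))
     (- (lw2 N u i y t - lw2 N u i x t - L * de * cutoff2 i x)).
    have D3 := lw_line2 i uC tn xl wx0.
    have D4 := lw_line2 i uC tn yl wy0.
    derive_rules; ring.
  have := deriv2_min m0 D1 D2; rewrite !scale0r !addr0 => H.
  have : 0 <= - (lw2 N u i y t - lw2 N u i x t - L * de * cutoff2 i x).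
    by apply: H => s sm; rewrite lerN2; have [] := maxx i s (lt_le_trans sm md).
  lra.
have Ti : L * de * - ((t - t0 + 1) ^+ 2)^-1 <= lwt N u y t - lwt N u x t.
  have D1 := lw_time uC tn xl wx0; have D2 := lw_time uC tn yl wy0.
  have D3 := cutoff_time x t1.
  have D : is_derive t 1 (fun s => - Psi N L ep u x y s)
     (- (lwt N u y t - lwt N u x t - L * de * - ((t - t0 + 1) ^+ 2)^-1)).
    by rewrite /Psi -/v -/de; derive_rules; ring.
  have := deriv_left_min D dd0 => H.
  have : - (lwt N u y t - lwt N u x t - L * de * - ((t - t0 + 1) ^+ 2)^-1) <= 0.
    by apply: H => s sd; rewrite lerN2; exact: maxt.
  lra.
have Hx := lw_pde hp us tn xl wx0; have Hy := lw_pde hp us tn yl wy0.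
set SP := \sum_i lw1 N u i x t ^+ 2 in Hx.
have e1 : \sum_i e i ^+ 2 = 1.
  rewrite /e (eq_bigr (fun i => v 0 i ^+ 2 * (nrm v ^+ 2)^-1)); last first.
    by move=> i _; rewrite expr_div_n.
  by rewrite -mulr_suml -/(sqn v) /nrm sqr_sqrtr ?sqn_ge0// divff// gt_eqF.
have SQE : \sum_i lw1 N u i y t ^+ 2 = (L * E) ^+ 2.
  rewrite (eq_bigr (fun i => (L * E) ^+ 2 * e i ^+ 2)); last by move=> i _; rewrite Qi; ring.
  by rewrite -mulr_sumr e1 mulr1.
have dge : (1 : R) <= d by rewrite ler1n.
have L0 : 0 < L by lra.
have LE0 : 0 < L * E by rewrite mulr_gt0//; lra.
rewrite SQE sqrtr_sqr (gtr0_norm LE0) in Hy.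
set a := (2 * N - u x t) `^ (p - 1) in Hx; set b := (2 * N - u y t) `^ (p - 1) in Hy.
set P := Num.sqrt SP in Hx.
have SP0 : 0 <= SP by apply: sumr_ge0 => i _; exact: sqr_ge0.
have P2 : P ^+ 2 = SP by rewrite /P sqr_sqrtr.
have P0 : 0 <= P by exact: sqrtr_ge0.
have k0 : 0 < 2 * E ^+ 2 by rewrite mulr_gt0// exprn_gt0//; lra.
have CS := sum_unit_le k0 e1 Eg.
set I := \sum_i e i * cutoff1 i x in CS.
have SPE : SP = (L * E) ^+ 2 + 2 * (L * E) * (L * de) * I + (L * de) ^+ 2 * \sum_i cutoff1 i x ^+ 2.
  have -> : (L * E) ^+ 2 = \sum_i (L * E) ^+ 2 * e i ^+ 2 by rewrite -mulr_sumr e1 mulr1.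
  rewrite /I !mulr_sumr -!big_split/=; apply: eq_bigr => i _.
  by rewrite Pi; ring.
have LD0 : 0 < L * de by rewrite mulr_gt0.
have gk : 0 < 2 * (L * E) * (L * de) by rewrite mulr_gt0// mulr_gt0.
move: CS; rewrite ler_norml => /andP[I1 I2].
have a1 : 1 <= a by apply: powR_ge1; lra.
(* [Psi > 0] bounds [lw] at [y] minus [lw] at [x] below by [L E de]; exponentiating compares the
   values of [2 N - u], hence their powers [a] and [b]. *)
have ab : a * expR ((p - 1) * (L * E * de)) <= b.
  have H : L * E * de <= lw N u y t - lw N u x t by move: Psi0; rewrite /Psi -/E -/v -/de; lra.
  have H2 : (2 * N - u x t) * expR (L * E * de) <= 2 * N - u y t.
    have EX : expR (lw N u x t) = 2 * N - u x t by rewrite /lw lnK.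
    have EY : expR (lw N u y t) = 2 * N - u y t by rewrite /lw lnK.
    by rewrite -EX -EY -expRD ler_expR addrC -lerBrDr.
  have -> : a * expR ((p - 1) * (L * E * de)) = ((2 * N - u x t) * expR (L * E * de)) `^ (p - 1).
    rewrite powRM ?expR_ge0 ?(ltW wx0)//; congr (_ * _).
    by rewrite /powR gt_eqF ?expR_gt0// expRK.
  by apply: powR_le => //; [lra | rewrite mulr_ge0 ?expR_ge0// ltW].
have Pg : P <= L * E + L * de * (2 * E ^+ 2).
  rewrite -(@ler_pXn2r _ 2)// ?nnegrE ?addr_ge0 ?(ltW LE0)//; last by rewrite mulr_ge0 ?(ltW LD0) ?(ltW k0).
  rewrite P2 SPE.
  have H1 : 2 * (L * E) * (L * de) * I <= 2 * (L * E) * (L * de) * (2 * E ^+ 2) by rewrite ler_pM2l.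
  have H2 : (L * de) ^+ 2 * \sum_i cutoff1 i x ^+ 2 <= (L * de) ^+ 2 * (2 * E ^+ 2) ^+ 2.
    by rewrite ler_pM2l// exprn_gt0.
  have -> : (L * E + L * de * (2 * E ^+ 2)) ^+ 2 = (L * E) ^+ 2 + 2 * (L * E) * (L * de) * (2 * E ^+ 2) + (L * de) ^+ 2 * (2 * E ^+ 2) ^+ 2 by ring.
  lra.
have Pq : (L * E) ^+ 2 - P ^+ 2 <= 2 * (L * E) * (L * de * (2 * E ^+ 2)).
  rewrite P2 SPE.
  have H1 : 2 * (L * E) * (L * de) * - (2 * E ^+ 2) <= 2 * (L * E) * (L * de) * I by rewrite ler_pM2l.
  have H2 : 0 <= (L * de) ^+ 2 * \sum_i cutoff1 i x ^+ 2.
    by rewrite mulr_ge0 ?sqr_ge0//; apply: sumr_ge0 => i _; exact: sqr_ge0.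
  have -> : 2 * (L * E) * (L * de * (2 * E ^+ 2)) = - (2 * (L * E) * (L * de) * - (2 * E ^+ 2)) by ring.
  lra.
have := doubling_absurd hp dge LE E1 de0 a1 ab P0 Pg Pq Et.
apply/negP; rewrite -leNgt.
have SD : \sum_i lw2 N u i y t - \sum_i lw2 N u i x t <= L * de * \sum_i cutoff2 i x.
  by rewrite -sumrB mulr_sumr; apply: ler_sum => i _; exact: Di.
rewrite P2 mulrDr mulrN.
lra.
Qed.

End Doubling.

(** * The gradient estimate at height 3 *)

Section Gradient.
Variables (R : realType) (n : nat).
Implicit Types (u : 'rV[R]_n.+1 -> R -> R) (x y v : 'rV[R]_n.+1) (i : 'I_n.+1).
Notation d := (n.+1%:R : R).
Notation point2 := (('rV[R]_n.+1 * 'rV[R]_n.+1) * R)%type.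

Lemma near_lines2 x y (t : R) (P : point2 -> Prop) : (\forall z \near ((x, y), t), P z) ->
  exists2 e, 0 < e & (forall i s, `|s| < e ->
     [/\ P ((x + s *: ebase R i, y), t), P ((x, y + s *: ebase R i), t) &
         P ((x + s *: ebase R i, y + s *: ebase R i), t)]) /\
     (forall s, t - e < s < t -> P ((x, y), s)).
Proof.
move=> /nbhs_ballP [e /= e0 H]; exists e => //.
have B v i s : `|s| < e -> ball v e (v + s *: ebase R i).
  move=> se; split=> // j k; rewrite /ball/= !mxE opprD addrA subrr sub0r normrN normrM.
  by case: (_ && _); rewrite ?normr1 ?normr0 ?mulr1 ?mulr0.
have B0 v : ball v e v by exact: ballxx.
have Bt : ball t e t by exact: ballxx.
split=> [i s se|s /andP[s1 s2]].
  have b1 := B x i s se; have b2 := B y i s se.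
  by split; apply: H; split => //=; split.
apply: H; split => /=; first by split.
by rewrite /ball/= gtr0_norm; lra.
Qed.

Lemma sqnD_le v y : sqn (v + y) <= 2 * sqn v + 2 * sqn y.
Proof.
rewrite /sqn !mulr_sumr -big_split/=; apply: ler_sum => i _; rewrite mxE.
have := sqr_ge0 (v 0 i - y 0 i); nra.
Qed.

Lemma xlast_dist x y : sqn (x - y) <= 1 -> `|xlast x - xlast y| <= 1.
Proof.
move=> xy; have := le_trans (coord_sqn (x - y) ord_max) xy; rewrite !mxE.
by rewrite -/(xlast x) -/(xlast y) => H; rewrite ler_norml; apply/andP; split; nra.
Qed.

(** A penalty below 2 forces [E < 1 / th], because [2 th <= L ep], whereas [E > 1 / th] on the faces
    of the localisation; it also forces [m < 1], because [L E >= 24]. Thus a positive maximum of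
    [Psi], where the penalty is below the oscillation of [lw], avoids these faces. *)
Lemma cutoff_gap x0 x (t0 t L ep th m : R) : 24 <= L -> 0 < ep -> 0 < th -> th < 1 -> 2 * th <= L * ep ->
  0 <= m -> sqn (x - x0) <= 1 - th -> t0 - 1 + th <= t <= t0 ->
  L * cutoff x0 t0 x t * (m + ep) < 2 ->
  [/\ sqn (x - x0) < 1 - th, t0 - 1 + th < t & m < 1].
Proof.
move=> L24 ep0 th0 th1 thL m0 x1 /andP[t1 t2] HL.
have x1' : sqn (x - x0) < 1 by lra.
have t1' : t0 - 1 < t <= t0 by apply/andP; split; lra.
have [E1 _ _] := cutoff_bounds x1' t1'.
set E := cutoff x0 t0 x t in E1 HL.
have L0 : 0 < L by lra.
have LE0 : 0 < L * E by rewrite mulr_gt0//; lra.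
have LE1 : L <= L * E by rewrite ler_peMr// ltW.
have LthL : 2 <= L * th^-1 * ep by rewrite mulrAC ler_pdivlMr.
have Lm : 0 <= L * E * m by rewrite mulr_ge0// ltW.
have Le : 0 < L * E * ep by rewrite mulr_gt0.
rewrite mulrDr in HL.
have Eth : E < th^-1.
  rewrite ltNge; apply/negP => H.
  have : L * th^-1 * ep <= L * E * ep by rewrite ler_pM2r// ler_pM2l.
  lra.
split.
- rewrite lt_neqAle x1; apply/andP; split => //; apply/negP => /eqP H.
  have B0 : 0 < (t - t0 + 1)^-1 by rewrite invr_gt0; lra.
  by move: Eth; rewrite /E /cutoff H subKr; lra.
- rewrite lt_neqAle t1; apply/andP; split => //; apply/negP => /eqP H.
  have A0 : 0 < (1 - sqn (x - x0))^-1 by rewrite invr_gt0; lra.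
  move: Eth; rewrite /E /cutoff -H (_ : t0 - 1 + th - t0 + 1 = th); last by ring.
  lra.
- rewrite ltNge; apply/negP => m1.
  have : L * E * 1 <= L * E * m by rewrite ler_pM2l.
  lra.
Qed.

Lemma lw_osc N u x y t : 1 <= N -> u x t <= N -> 0 <= u y t -> 0 < 2 * N - u y t ->
  lw N u y t - lw N u x t < 2.
Proof.
move=> N1 ux uy wy; have w0 : 0 < 2 * N - u x t by lra.
have H : lw N u y t <= ln (2 * (2 * N - u x t)) by rewrite /lw ler_ln ?posrE; lra.
rewrite lnM ?posrE// in H; have := @ln_sublinear R 2 ltac:(lra); rewrite /lw in H *; lra.
Qed.

Definition doubling_set x0 (t0 th : R) := [set z : point2 |
  [/\ sqn (z.1.1 - x0) <= 1 - th, sqn (z.1.1 - z.1.2) <= 1 & t0 - 1 + th <= z.2 <= t0]].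

Lemma point2_continuous x0 :
  [/\ continuous (fun z : point2 => z.1.1), continuous (fun z : point2 => z.1.2),
      continuous (fun z : point2 => z.2), continuous (fun z : point2 => sqn (z.1.1 - x0)) &
      continuous (fun z : point2 => sqn (z.1.1 - z.1.2))].
Proof.
have c11 : continuous (fun z : point2 => z.1.1).
  by move=> z; apply: (@continuous_comp _ _ _ fst fst); exact: cvg_fst.
have c12 : continuous (fun z : point2 => z.1.2).
  by move=> z; apply: (@continuous_comp _ _ _ fst snd); [exact: cvg_fst | exact: cvg_snd].
split=> //; first by move=> z; exact: cvg_snd.
  move=> z; apply: cvg_sqn.
  by apply: (@cvgB R 'rV[R]_n.+1 _ (nbhs z) (nbhs_filter z) _ (fun=> x0) _ x0 (c11 z)); exact: cvg_cst.
move=> z; apply: cvg_sqn.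
exact: (@cvgB R 'rV[R]_n.+1 _ (nbhs z) (nbhs_filter z) _ _ _ _ (c11 z) (c12 z)).
Qed.

Lemma doubling_set_compact x0 (t0 th : R) : 0 < th -> compact (doubling_set x0 t0 th).
Proof.
move=> th0; have [_ _ c2 cx cxy] := point2_continuous x0.
apply: (@subclosed_compact _ _ (([set x | sqn (x - x0) <= 1] `*` [set x | sqn (x - x0) <= 4]) `*` `[t0 - 1, t0])).
- have -> : doubling_set x0 t0 th = [set z : point2 | sqn (z.1.1 - x0) <= 1 - th] `&`
     [set z : point2 | sqn (z.1.1 - z.1.2) <= 1] `&` [set z : point2 | t0 - 1 + th <= z.2] `&` [set z : point2 | z.2 <= t0].
    apply/seteqP; split => z /=; first by move=> [? ? /andP[? ?]].
    by move=> [[[? ?] ?] ?]; split => //; apply/andP.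
  apply: closedI; [apply: closedI; [apply: closedI|]|].
  + exact: (closed_le_fun cx (@cst_continuous _ _ (1 - th))).
  + exact: (closed_le_fun cxy (@cst_continuous _ _ (1 : R))).
  + exact: (closed_le_fun (@cst_continuous _ _ (t0 - 1 + th)) c2).
  + exact: (closed_le_fun c2 (@cst_continuous _ _ t0)).
- apply: compact_setX; last exact: segment_compact.
  by apply: compact_setX; exact: compact_ball_sqn.
- move=> z [z1 z2 /andP[z3 z4]]; split; [split|] => /=.
  + lra.
  + have := sqnD_le (z.1.2 - z.1.1) (z.1.1 - x0); rewrite subrKA (sqnB z.1.2 z.1.1); lra.
  + by rewrite in_itv/=; apply/andP; split; lra.
Qed.

(** [x] is within distance 1 of [x0], and [y] within distance 1 of [x]; from height 3 this leaves
    heights between 1 and 5. *)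
Lemma doubling_set_bounds N u x0 (t0 th : R) (z : point2) : 0 < th -> xlast x0 = 3 ->
  (forall x t, 1 <= xlast x <= 5 -> t <= t0 -> 0 <= u x t <= N) ->
  doubling_set x0 t0 th z ->
  [/\ 1 <= xlast z.1.1, 1 <= xlast z.1.2, 0 <= u z.1.1 z.2 <= N & 0 <= u z.1.2 z.2 <= N].
Proof.
move=> th0 x03 Hb [z1 z2 /andP[_ zt]].
have /xlast_dist : sqn (z.1.1 - x0) <= 1 by lra.
rewrite x03 ler_norml => /andP[h1 h2].
move: (xlast_dist z2); rewrite ler_norml => /andP[h3 h4].
by split; [lra | lra | |]; apply: Hb => //; apply/andP; split; lra.
Qed.

Lemma lw_continuous N u (v : point2 -> 'rV[R]_n.+1) (z : point2) : C21_Q u -> {for z, continuous v} ->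
  0 < xlast (v z) -> z.2 < 0 -> 0 < 2 * N - u (v z) z.2 ->
  (fun z => lw N u (v z) z.2) @ z --> lw N u (v z) z.2.
Proof.
move=> uC cv vz zt w0; rewrite /lw.
apply: (@continuous_cvg _ _ _ _ _ _ (@ln R)); first exact: continuous_ln.
apply: (@cvgB R R _ (nbhs z) (nbhs_filter z) (fun=> 2 * N)); first exact: cvg_cst.
have Qz : Qset (v z, z.2) by split.
have [_ [cu _ _ _]] := uC _ Qz.
apply: (@continuous_cvg _ _ _ (nbhs z) (nbhs_filter z) (fun z => (v z, z.2)) (unc u) (v z, z.2)).
  exact: cu.
have [_ _ c2 _ _] := point2_continuous 0.
exact: (@cvg_pair _ _ _ _ _ _ (nbhs_filter _) (nbhs_filter _) (nbhs_filter _) _ _ cv (c2 z)).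
Qed.

Lemma Psi_continuous N L ep u x0 (t0 th : R) : C21_Q u -> t0 < 0 -> 0 < th -> 1 <= N ->
  xlast x0 = 3 -> (forall x t, 1 <= xlast x <= 5 -> t <= t0 -> 0 <= u x t <= N) ->
  {within doubling_set x0 t0 th,
    continuous (fun z : point2 => Psi x0 t0 N L ep u z.1.1 z.1.2 z.2)}.
Proof.
move=> uC t00 th0 N1 x03 Hb.
have [c11 c12 c2 cx cxy] := point2_continuous x0.
apply: continuous_in_subspaceT => z; rewrite inE => Kz.
have [hx hy /andP[ux0 uxN] /andP[uy0 uyN]] := doubling_set_bounds th0 x03 Hb Kz.
have [z1 _ /andP[z3 z4]] := Kz.
have wx0 : 0 < 2 * N - u z.1.1 z.2 by lra.
have wy0 : 0 < 2 * N - u z.1.2 z.2 by lra.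
have zt : z.2 < 0 by lra.
have hx0 : 0 < xlast z.1.1 by lra.
have hy0 : 0 < xlast z.1.2 by lra.
rewrite /Psi; apply: cvgB; first apply: cvgB.
- exact: (lw_continuous uC (c12 z) hy0 zt wy0).
- exact: (lw_continuous uC (c11 z) hx0 zt wx0).
- apply: cvgM; last first.
    apply: cvgD; last exact: cvg_cst.
    by apply: (@continuous_cvg _ _ _ _ _ _ (@Num.sqrt R)); [exact: sqrt_continuous | exact: cxy].
  apply: cvgM; first exact: cvg_cst.
  rewrite /cutoff; apply: cvgD; apply: cvgV.
  + by rewrite gt_eqF//; lra.
  + by apply: cvgB; [exact: cvg_cst | exact: cx].
  + by rewrite gt_eqF//; lra.
  + by apply: cvgD; [apply: cvgB; [exact: c2 | exact: cvg_cst] | exact: cvg_cst].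
Qed.

(** A positive value yields a positive maximum over the compact [doubling_set]. By [cutoff_gap] it
    is off the faces, apart from the final time, and [doubling_no_max] excludes it. *)
Lemma doubling_nonpos p N ep u x0 t0 y0 : 2 <= p -> ancient_solution p u ->
  xlast x0 = 3 -> t0 < 0 -> 1 <= N -> 0 < ep ->
  (forall x t, 1 <= xlast x <= 5 -> t <= t0 -> 0 <= u x t <= N) ->
  sqn (x0 - y0) <= 1 ->
  Psi x0 t0 N (20 + 4 * d) ep u x0 y0 t0 <= 0.
Proof.
move=> hp us x03 t00 N1 ep0 Hb xy0; rewrite leNgt; apply/negP.
have [L LE] : exists L, L = 20 + 4 * d by exists (20 + 4 * d).
rewrite -LE => Psi0.
have L24 : 24 <= L by have : (1 : R) <= d by [rewrite ler1n]; lra.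
have [th [th0 th1 thL]] : exists th, [/\ 0 < th, th < 1 & 2 * th <= L * ep].
  have Lep : 0 < L * ep by rewrite mulr_gt0//; lra.
  exists (Num.min (1 / 2) (L * ep / 2)).
  have m1 : Num.min (1 / 2) (L * ep / 2) <= 1 / 2 by rewrite ge_min lexx.
  have m2 : Num.min (1 / 2) (L * ep / 2) <= L * ep / 2 by rewrite ge_min lexx orbT.
  by split; [rewrite lt_min; apply/andP; split; lra | lra | lra].
have [uC _ _ _] := us.
have [_ _ c2 cx cxy] := point2_continuous x0.
pose K := doubling_set x0 t0 th.
pose f (z : point2) := Psi x0 t0 N L ep u z.1.1 z.1.2 z.2.
have K0 : K ((x0, y0), t0) by split => /=; rewrite ?subrr ?sqn0; lra.
have [z] := compact_EVT_max (ex_intro _ _ K0) (@doubling_set_compact x0 t0 th th0)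
  (Psi_continuous (L := L) (ep := ep) uC t00 th0 N1 x03 Hb).
rewrite inE => Kz maxz0.
have maxz z' : K z' -> f z' <= f z by move=> Kz'; apply: maxz0; rewrite inE.
have fz0 : 0 < f z by apply: lt_le_trans (maxz _ K0).
move: z Kz maxz fz0 {maxz0} => [[x y] t] Kz maxz fz0.
have [/= z1 z2 z3] := Kz.
have [/= hx hy /andP[ux0 uxN] /andP[uy0 uyN]] := doubling_set_bounds th0 x03 Hb Kz.
have wy0 : 0 < 2 * N - u y t by clear - N1 uyN; lra.
have nv : 0 <= nrm (x - y) by exact: sqrtr_ge0.
have HL : L * cutoff x0 t0 x t * (nrm (x - y) + ep) < 2.
  have := lw_osc N1 uxN uy0 wy0; move: fz0; rewrite /f /Psi/=; clear; lra.
have [z1' z3' m1] := cutoff_gap L24 ep0 th0 th1 thL nv z1 z3 HL.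
have x1 : sqn (x - x0) < 1 by clear - z1' th0; lra.
have [z4 zt] := andP z3.
have t1 : t0 - 1 < t <= t0 by clear - z3' th0 zt; apply/andP; split; lra.
have [E1 _ _] := cutoff_bounds x1 t1.
have z2' : sqn (x - y) < 1.
  by move: m1; rewrite /nrm -[ltRHS]sqrtr1 ltr_sqrt.
(* On the diagonal [Psi] is minus the penalty, so the maximum lies where the distance is
   differentiable. *)
have xy : x != y.
  apply/negP => /eqP H; move: fz0; rewrite /f /Psi/= H subrr sub0r oppr_gt0 ltNge.
  rewrite !mulr_ge0//; [clear - L24; lra | by rewrite -H; clear - E1; lra|].
  by rewrite addr_ge0 ?(ltW ep0)// sqrtr_ge0.
have Kn : \forall z' \near ((x, y), t), z'.2 <= t0 -> K z'.
  near=> z' => z't; split.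
  - by apply: ltW; near: z'; exact: (cvgr_lt _ (cx ((x, y), t)) _ z1').
  - by apply: ltW; near: z'; exact: (cvgr_lt _ (cxy ((x, y), t)) _ z2').
  - by rewrite z't andbT; apply: ltW; near: z'; exact: (cvgr_gt _ (c2 ((x, y), t)) _ z3').
have [dd dd0 [Hs Ht]] := near_lines2 Kn.
have wx1 : 1 <= 2 * N - u x t by clear - N1 uxN; lra.
have tn : t < 0 by clear - zt t00; lra.
have hx0 : 0 < xlast x by clear - hx; lra.
have hy0 : 0 < xlast y by clear - hy; lra.
apply: (doubling_no_max hp us LE ep0 dd0 tn hx0 hy0 wx1 wy0 x1 t1 xy fz0) => [i s sd|s sd].
  have [/= H1 H2 H3] := Hs i s sd.
  have K1 := H1 zt; have K2 := H2 zt; have K3 := H3 zt.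
  have [_ _ /andP[/= _ w1] _] := doubling_set_bounds th0 x03 Hb K1.
  have [_ _ _ /andP[/= _ w2]] := doubling_set_bounds th0 x03 Hb K2.
  split; [clear - N1 w1; lra | clear - N1 w2; lra | exact: (maxz _ K1) | exact: (maxz _ K2) | exact: (maxz _ K3)].
have /andP[_ st] := sd; apply: (maxz ((x, y), s)); apply: (Ht s sd) => /=.
exact: le_trans (ltW st) zt.
Unshelve. all: by end_near.
Qed.

(** [doubling_nonpos] at [x = x0], with [ep] tending to 0, is a one-sided Lipschitz bound for [lw]
    with constant [2 L]. Comparing on both sides along a coordinate bounds [lw1] by [2 L], and
    multiplication by [2 N - u <= 2 N] returns to [u]. *)
Lemma gradient_height3 p N u x0 t0 i : 2 <= p -> ancient_solution p u ->
  xlast x0 = 3 -> t0 < 0 -> 1 <= N ->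
  (forall x t, 1 <= xlast x <= 5 -> t <= t0 -> 0 <= u x t <= N) ->
  `|pdx i u x0 t0| <= 4 * (20 + 4 * d) * N.
Proof.
move=> hp us x03 t00 N1 Hb; set L := 20 + 4 * d.
have dge : (1 : R) <= d by rewrite ler1n.
have L24 : 24 <= L by rewrite /L; lra.
have /andP[u0 uN] : 0 <= u x0 t0 <= N by apply: Hb => //; rewrite x03; apply/andP; split; lra.
have w0 : 0 < 2 * N - u x0 t0 by lra.
have lip s : `|s| < 1 -> lw N u (x0 + s *: ebase R i) t0 - lw N u x0 t0 <= 2 * L * `|s|.
  move=> s1; apply/ler_addgt0Pr => e e0.
  (* The cutoff equals 2 at [(x0, t0)], so this [ep] contributes exactly [e]. *)
  have ep0 : 0 < e / (2 * L) by apply: divr_gt0; lra.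
  have sq : sqn (x0 - (x0 + s *: ebase R i)) = s ^+ 2.
    by rewrite opprD addrA subrr -scaleNr sqn_line sqn0 mxE; ring.
  have xy : sqn (x0 - (x0 + s *: ebase R i)) <= 1.
    by rewrite sq -real_normK ?num_real// expr_le1// ltW.
  have := doubling_nonpos hp us x03 t00 N1 ep0 Hb xy; rewrite /Psi /nrm sq sqrtr_sqr.
  have -> : cutoff x0 t0 x0 t0 = 2 by rewrite /cutoff !subrr sqn0 subr0 add0r invr1; lra.
  rewrite mulrDr -/L (_ : L * 2 * (e / (2 * L)) = e); last by field; rewrite gt_eqF//; lra.
  lra.
have [uC _ _ _] := us.
have n0 : `|0 : R| < xlast x0 by rewrite normr0 x03; lra.
have w0' : 0 < 2 * N - u (x0 + 0 *: ebase R i) t0 by rewrite scale0r addr0.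
have D := lw_line uC t00 n0 w0'; rewrite scale0r addr0 in D.
have DR : is_derive (0 : R) 1 (fun s => 2 * L * s - lw N u (x0 + s *: ebase R i) t0)
   (2 * L - lw1 N u i x0 t0) by derive_rules; ring.
have DL : is_derive (0 : R) 1 (fun s => - (2 * L * s) - lw N u (x0 + s *: ebase R i) t0)
   (- (2 * L) - lw1 N u i x0 t0) by derive_rules; ring.
have HR : 0 <= 2 * L - lw1 N u i x0 t0.
  apply: (deriv_right_min DR ltr01) => s /andP[s1 s2].
  rewrite scale0r addr0 mulr0; have := lip s; rewrite gtr0_norm// => /(_ ltac:(lra)); lra.
have HL : - (2 * L) - lw1 N u i x0 t0 <= 0.
  apply: (deriv_left_min DL ltr01) => s /andP[s1 s2].
  rewrite scale0r addr0 mulr0; have := lip s; rewrite ltr0_norm// => /(_ ltac:(lra)); lra.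
have E : pdx i u x0 t0 = - lw1 N u i x0 t0 * (2 * N - u x0 t0).
  by rewrite /lw1; field; rewrite gt_eqF.
rewrite E normrM normrN (gtr0_norm w0).
have H1 : `|lw1 N u i x0 t0| <= 2 * L by rewrite ler_norml; apply/andP; split; lra.
have -> : 4 * L * N = 2 * L * (2 * N) by ring.
by apply: ler_pM => //; [exact: ltW | lra].
Qed.

End Gradient.

(** * Rescaled bounds and conclusion *)

Section Final.
Variables (R : realType) (n : nat) (p : R).
Implicit Types (u : 'rV[R]_n.+1 -> R -> R) (x : 'rV[R]_n.+1).
Notation d := (n.+1%:R : R).
Notation be := ((p - 1)^-1).
Notation C0 := (@bound_const R n p).

Lemma bound_const_gt0 : 2 < p -> 0 < C0.
Proof. by move=> hp; have [k0 c0 ct0] := barrier_consts n hp; rewrite /bound_const; lra. Qed.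

Lemma dilation_powR (l t : R) : 0 < l -> t < 0 ->
  (- (t / l ^+ 2)) `^ (- be) = (- t) `^ (- be) * (l `^ be * l `^ be).
Proof.
move=> l0 t0; rewrite -mulNr powRM ?oppr_ge0 ?(ltW t0)//; last first.
  by rewrite invr_ge0 exprn_ge0// ltW.
congr (_ * _); rewrite -powRD; last by rewrite (gt_eqF l0) implybT.
have -> : (l ^+ 2)^-1 = l `^ (- 2) by rewrite powRN (powR_mulrn 2)// ltW.
by rewrite -powRrM; congr (_ `^ _); ring.
Qed.

Lemma upper_bound u x t : 2 < p -> ancient_solution p u -> 0 < xlast x -> t < 0 ->
  u x t <= 2 * C0 * (xlast x `^ (1 - be) + xlast x `^ (1 + be) * (- t) `^ (- be)).
Proof.
move=> hp us x0 t0; set l := xlast x in x0 *.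
have [/andP[b0 b1] _] := conj_exp hp.
have C00 := bound_const_gt0 hp.
pose c := l `^ (be - 1); have c0 : 0 < c by rewrite powR_gt0.
have vs := rescale_ancient x0 hp (erefl c) us.
pose y := l^-1 *: x; pose s := t / l ^+ 2.
have ln0 : l != 0 by rewrite gt_eqF.
have l2 : 0 < l ^+ 2 by rewrite exprn_gt0.
have y1 : xlast y = 1 by rewrite /y xlast_scale mulVf.
have s0 : s < 0 by rewrite /s pmulr_llt0// invr_gt0.
have vE : rescale l c u y s = c * u x t.
  by rewrite /rescale /y /s scalerA mulfV// scale1r [l ^+ 2 * _]mulrC divfK// gt_eqF.
(* The time span is at most 1, as the barrier requires, and ends before time 0. The halving costs
   the factor [2 ^ be <= 2] below. *)
pose T := Num.min 1 (- s / 2).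
have T0 : 0 < T by rewrite lt_min ltr01; lra.
have T1 : T <= 1 by rewrite ge_min lexx.
have T01 : 0 < T <= 1 by rewrite T0.
have Ts : T <= - s / 2 by rewrite ge_min lexx orbT.
have sT : s + T < 0 by lra.
have := bound_height1 hp vs y1 T01 sT; rewrite vE.
have TB : T `^ (- be) <= 1 + 2 * (- s) `^ (- be).
  have S0 := powR_ge0 (- s) (- be).
  rewrite /T; case: (leP 1 (- s / 2)) => _.
    by rewrite powR1; lra.
  rewrite powRM; [|lra|lra].
  have -> : 2^-1 `^ (- be) = 2 `^ be :> R.
    by rewrite -(powR_inv1 (_ : 0 <= 2 :> R))// -powRrM mulN1r opprK.
  have : 2 `^ be <= 2 :> R by rewrite -[leRHS](powRr1 (_ : 0 <= 2 :> R))//; apply: ler_powR; lra.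
  nra.
have lp k := powR_gt0 k x0.
move=> H; have {}H : c * u x t <= 2 * C0 * (1 + (- s) `^ (- be)).
  apply: le_trans H _.
  have -> : 2 * C0 * (1 + (- s) `^ (- be)) = C0 * (2 + 2 * (- s) `^ (- be)) by ring.
  by rewrite ler_pM2l//; lra.
rewrite /s dilation_powR// in H.
have cV : c * l `^ (1 - be) = 1.
  rewrite /c -powRD; last by rewrite (gt_eqF x0) implybT.
  by rewrite (_ : _ + _ = 0) ?powRr0//; ring.
have l1 : l `^ (1 + be) = l `^ (1 - be) * (l `^ be * l `^ be).
  rewrite -!powRD ?(gt_eqF x0) ?implybT//; congr (_ `^ _); ring.
have -> : u x t = l `^ (1 - be) * (c * u x t) by rewrite mulrA (mulrC _ c) cV mul1r.
rewrite l1.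
apply: (@le_trans _ _ (l `^ (1 - be) * (2 * C0 * (1 + (- t) `^ (- be) * (l `^ be * l `^ be))))).
  by rewrite ler_pM2l.
by rewrite le_eqVlt; apply/orP; left; apply/eqP; ring.
Qed.

Lemma gradnorm_le u x t (k : R) : 0 <= k -> (forall i, `|pdx i u x t| <= k) ->
  gradnorm u x t <= d * k.
Proof.
move=> k0 H; have dge : (1 : R) <= d by rewrite ler1n.
have dk : 0 <= d * k by rewrite mulr_ge0.
rewrite /gradnorm -[leRHS](ger0_norm dk) -sqrtr_sqr ler_sqrt ?sqr_ge0//.
apply: (@le_trans _ _ (\sum_(i < n.+1) k ^+ 2)).
  apply: ler_sum => i _; rewrite -[leLHS]real_normK ?num_real//.
  by rewrite lerXn2r ?nnegrE.
have E : (d * k) ^+ 2 = k ^+ 2 * d * d by ring.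
rewrite E sumr_const card_ord -[leLHS]mulr_natr.
by apply: ler_peMr; [rewrite mulr_ge0// sqr_ge0 | exact: dge].
Qed.

Lemma gradient_bound u x t : 2 < p -> ancient_solution p u -> 0 < xlast x -> t < 0 ->
  gradnorm u x t <= 3 * (d * (4 * (20 + 4 * d) * (1 + 50 * C0))) *
    (xlast x `^ (- be) + xlast x `^ be * (- t) `^ (- be)).
Proof.
move=> hp us x0 t0; set h := xlast x in x0 *.
have hp' : 2 <= p by lra.
have [/andP[b0 b1] _] := conj_exp hp.
have C00 := bound_const_gt0 hp.
have dge : (1 : R) <= d by rewrite ler1n.
pose l := h / 3; have l0 : 0 < l by rewrite divr_gt0.
pose c := l `^ (be - 1); have c0 : 0 < c by rewrite powR_gt0.
have vs := rescale_ancient l0 hp (erefl c) us.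
set v := rescale l c u in vs.
pose y := l^-1 *: x; pose s := t / l ^+ 2.
have ln0 : l != 0 by rewrite gt_eqF.
have l2 : 0 < l ^+ 2 by rewrite exprn_gt0.
have y3 : xlast y = 3.
  by rewrite /y xlast_scale -/h /l; field; rewrite gt_eqF.
have s0 : s < 0 by rewrite /s pmulr_llt0// invr_gt0.
have [uC _ _ _] := us.
have Qy : Qset (y, s) by split; rewrite //= y3.
have gE : gradnorm v y s = c * l * gradnorm u x t.
  rewrite (gradnorm_rescale l0 c0 uC Qy) /y /s scalerA mulfV// scale1r.
  by rewrite [l ^+ 2 * _]mulrC divfK// gt_eqF.
set S := (- s) `^ (- be); have S0 : 0 <= S by exact: powR_ge0.
(* On heights 1 to 5 and times up to [s] the upper bound is at most [2 C0 (5 + 25 S)]; the summand 1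
   ensures [N >= 1]. *)
pose N := 1 + 50 * C0 * (1 + S).
have CS0 : 0 <= C0 * S by rewrite mulr_ge0// ltW.
have N1 : 1 <= N by rewrite /N; lra.
have Hb z r : 1 <= xlast z <= 5 -> r <= s -> 0 <= v z r <= N.
  move=> /andP[z1 z5] rs; have z0 : 0 < xlast z by lra.
  have r0 : r < 0 by lra.
  rewrite (ancient_nonneg hp' vs z0 r0)/=.
  apply: le_trans (upper_bound hp vs z0 r0) _.
  have H1 : xlast z `^ (1 - be) <= 5.
    apply: le_trans (_ : xlast z `^ 1 <= _); first by apply: ler_powR; lra.
    by rewrite powRr1//; lra.
  have H2 : xlast z `^ (1 + be) <= 25.
    apply: (@le_trans _ _ (xlast z `^ 2)); first by apply: ler_powR; lra.
    rewrite (powR_mulrn 2); [nra|lra].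
  have H3 : (- r) `^ (- be) <= S.
    rewrite /S !powRN lef_pV2 ?posrE ?powR_gt0 ?oppr_gt0//.
    by apply: powR_le; lra.
  have H4 : xlast z `^ (1 + be) * (- r) `^ (- be) <= 25 * S.
    by apply: ler_pM; rewrite ?powR_ge0.
  have -> : N = 1 + 2 * C0 * (25 * (1 + S)) by rewrite /N; ring.
  apply: (@le_trans _ _ (2 * C0 * (25 * (1 + S)))); last by lra.
  by rewrite ler_pM2l; lra.
set k := 4 * (20 + 4 * d) * N.
have k0 : 0 <= k by rewrite /k mulr_ge0 ?mulr_ge0//; lra.
have := gradnorm_le k0 (fun i => gradient_height3 i hp' vs y3 s0 N1 Hb).
rewrite gE.
have cl : c * l = l `^ be.
  rewrite /c -{2}(powRr1 (ltW l0)) -powRD ?subrK//.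
  by rewrite (gt_eqF l0) implybT.
rewrite cl => H.
have lb0 : 0 < l `^ be by exact: powR_gt0.
have NS : N <= (1 + 50 * C0) * (1 + S) by rewrite /N; lra.
set Kc := d * (4 * (20 + 4 * d) * (1 + 50 * C0)).
have Kc0 : 0 <= Kc by rewrite /Kc !mulr_ge0//; lra.
have H1 : l `^ be * gradnorm u x t <= Kc * (1 + S).
  apply: le_trans H _; rewrite /k /Kc -!mulrA ler_pM2l; last by lra.
  rewrite ler_pM2l// ler_pM2l//; lra.
have H2 : gradnorm u x t <= Kc * (l `^ (- be) + l `^ be * (- t) `^ (- be)).
  rewrite -(ler_pM2l lb0); apply: le_trans H1 _.
  rewrite /S /s dilation_powR// [l `^ (- be)]powRN le_eqVlt; apply/orP; left; apply/eqP.
  by field; rewrite gt_eqF.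
apply: le_trans H2 _; rewrite -mulrA mulrCA; apply: ler_wpM2l => //.
have h0 := powR_gt0 (- be) x0; have hb0 := powR_gt0 be x0.
have t1 := powR_ge0 (- t) (- be).
(* Returning from [l = h / 3] to [h] costs [3 ^ be <= 3], the leading factor of the constant. *)
have L1 : l `^ (- be) <= 3 * h `^ (- be).
  rewrite /l powRM ?invr_ge0 ?(ltW x0)// mulrC ler_pM2r//.
  have -> : 3^-1 `^ (- be) = 3 `^ be :> R.
    by rewrite -(powR_inv1 (_ : 0 <= 3 :> R))// -powRrM mulN1r opprK.
  by rewrite -[leRHS](powRr1 (_ : 0 <= 3 :> R))//; apply: ler_powR; lra.
have L2 : l `^ be <= h `^ be by apply: powR_le; rewrite /l; lra.
have : l `^ be * (- t) `^ (- be) <= h `^ be * (- t) `^ (- be) by exact: ler_wpM2r.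
have := mulr_ge0 (ltW hb0) t1; lra.
Qed.

End Final.

Theorem theorem2p6 (R : realType) (n : nat) (p : R)
  (hp : 2 <= p) :
  (forall u : 'rV[R]_n.+1 -> R -> R, ancient_solution p u ->
     forall x t, 0 < xlast x -> t < 0 -> 0 <= u x t) /\
  (2 < p ->
   exists C : R, 0 < C /\
     forall u : 'rV[R]_n.+1 -> R -> R, ancient_solution p u ->
       forall x t, 0 < xlast x -> t < 0 ->
         u x t <= C * (xlast x `^ (1 - (p - 1)^-1)
                       + xlast x `^ (1 + (p - 1)^-1) * (- t) `^ (- (p - 1)^-1))
         /\ gradnorm u x t <= C * (xlast x `^ (- (p - 1)^-1)
                       + xlast x `^ ((p - 1)^-1) * (- t) `^ (- (p - 1)^-1))).
Proof.
split=> [u us|hp2]; first exact: (ancient_nonneg hp us).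
have C00 := bound_const_gt0 n hp2.
pose K : R := 3 * (n.+1%:R * (4 * (20 + 4 * n.+1%:R) * (1 + 50 * bound_const n p))).
have dge : (1 : R) <= n.+1%:R by rewrite ler1n.
have K0 : 0 <= K by rewrite /K !mulr_ge0//; lra.
(* The sum dominates the constants of both bounds and depends on [n] and [p] only. *)
exists (2 * bound_const n p + K); split; first lra.
move=> u us x t x0 t0.
have P a b c : 0 <= xlast x `^ a + xlast x `^ b * (- t) `^ c.
  by rewrite addr_ge0 ?mulr_ge0 ?powR_ge0.
split.
  apply: le_trans (upper_bound hp2 us x0 t0) _.
  by apply: ler_wpM2r => //; lra.
apply: le_trans (gradient_bound hp2 us x0 t0) _.
by apply: ler_wpM2r => //; rewrite -/K; lra.
Qed.
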